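(* Consider a sequence (indexed by the sample size $n\to\infty$) of linear models $\mathbf{y}=\mathbf{X}\boldsymbol{\beta}+\boldsymbol{\epsilon}$ as described in the context, satisfying assumptions (A1)–(A6) of the context. Suppose moreover that the following condition holds: there exists $C>0$ such that $|(\Pi_j X_j)^T X_k|\le C n^{-\gamma}$ for all $j\in\{1,\dots,p\}$ and all $k\in\mathcal{S}\setminus\mathcal{C}_j$ with $k\neq j$. Then $\mathbb{P}(\mathcal{E}_1)\to 1$, where $$\mathcal{E}_1=\Big\{\frac{|c_k^*(s_k)|}{\min_{j\in\mathcal{S}}|c_j^*(s_j)|}\to 0 \text{ for all } k\notin\mathcal{S}\Big\},$$ and this holds regardless of the choice of rescaling factor, i.e. both with $s_j=\lambda_j$ for all $j$ and with $s_j=\Lambda_j$ for all $j$. Moreover, on the event $\mathcal{E}_1$ the following hold (for either rescaling factor unless stated otherwise): (i) $n^{\mu}\, c_j^*\to 0$ for $j\notin\mathcal{S}$; (ii) $n^{\mu}\,|c_j^*|\to\infty$ for $j\in\mathcal{S}$; (iii) with the rescaling factor $\lambda_j$, $c_j^*(\lambda_j)/\beta_j\to 1$ whenever $\beta_j\neq 0$.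
   Context: Model: $\mathbf{y}=\mathbf{X}\boldsymbol{\beta}+\boldsymbol{\epsilon}$, where $\mathbf{y}\in\mathbb{R}^n$, $\mathbf{X}=(X_1,\dots,X_p)$ is an $n\times p$ design matrix whose columns satisfy $\|X_j\|_2=1$, $\boldsymbol{\beta}\in\mathbb{R}^p$, and $\epsilon_1,\dots,\epsilon_n$ are i.i.d. $\mathcal{N}(0,\sigma^2/n)$ with $\sigma^2<\infty$. The quantities $p,\mathbf{X},\boldsymbol{\beta}$ may depend on $n$. Let $\mathcal{S}=\{j:\beta_j\neq0\}$, $c_{j,k}=X_j^TX_k$, and for $\mathcal{D}\subseteq\{1,\dots,p\}$ let $\mathbf{X}_\mathcal{D}$, $\boldsymbol{\beta}_\mathcal{D}$ be the corresponding column submatrix / subvector. Given a threshold $\pi_n\in(0,1)$, let $\mathcal{C}_j=\{k\neq j: |c_{j,k}|>\pi_n\}$, let $\Pi_j$ be the orthogonal projection onto the span of $\{X_k:k\in\mathcal{C}_j\}$ (the zero matrix if $\mathcal{C}_j=\emptyset$), $X_j^*=(\mathbf{I}_n-\Pi_j)X_j$, $a_j=\|\Pi_jX_j\|_2^2/\|X_j\|_2^2$, $a_{jy}=\|\Pi_j\mathbf{y}\|_2^2/\|\mathbf{y}\|_2^2$, and the rescaling factors $\lambda_j=1-a_j$ and $\Lambda_j=\{(1-a_j)(1-a_{jy})\}^{1/2}$. The tilted correlation with rescaling factor $s_j$ is $c_j^*(s_j)=s_j^{-1}X_j^{*T}\mathbf{y}$; $c_j^*$ denotes it for either choice. Assumptions: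 (A1) $|\mathcal{S}|=O(n^{\delta})$ for some $\delta\in[0,1/2)$. (A2) $\log p=O(n^{\theta})$ with $\theta\in[0,1-2\gamma)$ for some $\gamma\in(\delta,1/2)$. (A3) With this $\gamma$, $\pi_n=C_1n^{-\gamma}$ for some $C_1>0$, and there is $C>0$ with $|\mathcal{C}_j|\le Cn^{\xi}$ uniformly in $j$, where $\xi\in[0,2(\gamma-\delta))$. (A4) $\max_{j\in\mathcal{S}}|\beta_j|<M$ for some $M\in(0,\infty)$ and $n^{\mu}\min_{j\in\mathcal{S}}|\beta_j|\to\infty$ for some $\mu\in[0,\gamma-\delta-\xi/2)$. (A5) There is $\alpha\in(0,1)$ with $1-a_j>\alpha$ for all $j$. (A6) For every $j$ with $\mathcal{S}\not\subseteq\mathcal{C}_j$, $n^{\kappa}\|(\mathbf{I}_n-\Pi_j)\mathbf{X}_\mathcal{S}\boldsymbol{\beta}_\mathcal{S}\|_2^2/\|\mathbf{X}_\mathcal{S}\boldsymbol{\beta}_\mathcal{S}\|_2^2\to\infty$, for some $\kappa$ with $\kappa/2+\mu\in[0,\gamma-\delta-\xi/2)$. *)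

(* Defs.v *)
From HB Require Import structures.
From mathcomp Require Import all_boot all_order all_algebra.
From mathcomp Require Import all_classical all_reals all_analysis.
Set Implicit Arguments. Unset Strict Implicit. Unset Printing Implicit Defensive.
Import Order.TTheory GRing.Theory Num.Theory.
Import numFieldNormedType.Exports.
Local Open Scope classical_set_scope.
Local Open Scope ring_scope.

Section LinearModel.
Variable R : realType.

Definition sqnorm {m : nat} (v : 'cV[R]_m) : R := \sum_i (v i 0) ^+ 2.

Definition corr {m p : nat} (X : 'M[R]_(m, p)) (j k : 'I_p) : R :=
  \sum_i X i j * X i k.

Definition Cset {m p : nat} (X : 'M[R]_(m, p)) (pi : R) (j : 'I_p) : {set 'I_p} :=
  [set k | (k != j) && (pi < `|corr X j k|)].

(* matrix whose rows are X_k^T for k in A (zero rows otherwise): its row space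
   is span{X_k : k in A} *)
Definition span_mx {m p : nat} (X : 'M[R]_(m, p)) (A : {set 'I_p}) : 'M[R]_(p, m) :=
  \matrix_(k, i) (if k \in A then X i k else 0).

Definition is_orthproj {q m : nat} (U : 'M[R]_(q, m)) (P : 'M[R]_m) : Prop :=
  [/\ P^T = P, P *m P = P & (P == U)%MS].

Definition orthproj {q m : nat} (U : 'M[R]_(q, m)) : 'M[R]_m :=
  xget 0 [set P | is_orthproj U P].

(* Pi_j : projection onto span{X_k : k in C_j} (zero matrix if C_j empty) *)
Definition Pi {m p : nat} (X : 'M[R]_(m, p)) (pi : R) (j : 'I_p) : 'M[R]_m :=
  orthproj (span_mx X (Cset X pi j)).

Definition Xstar {m p : nat} (X : 'M[R]_(m, p)) (pi : R) (j : 'I_p) : 'cV[R]_m :=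
  (1%:M - Pi X pi j) *m col j X.

Definition a_j {m p : nat} (X : 'M[R]_(m, p)) (pi : R) (j : 'I_p) : R :=
  sqnorm (Pi X pi j *m col j X) / sqnorm (col j X).

Definition a_jy {m p : nat} (X : 'M[R]_(m, p)) (pi : R) (j : 'I_p)
  (y : 'cV[R]_m) : R :=
  sqnorm (Pi X pi j *m y) / sqnorm y.

Definition lambda_j {m p : nat} (X : 'M[R]_(m, p)) (pi : R) (j : 'I_p) : R :=
  1 - a_j X pi j.

Definition Lambda_j {m p : nat} (X : 'M[R]_(m, p)) (pi : R) (j : 'I_p)
  (y : 'cV[R]_m) : R :=
  Num.sqrt ((1 - a_j X pi j) * (1 - a_jy X pi j y)).

Definition rescale (b : bool) {m p : nat} (X : 'M[R]_(m, p)) (pi : R)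
  (j : 'I_p) (y : 'cV[R]_m) : R :=
  if b then lambda_j X pi j else Lambda_j X pi j y.

Definition tilted (b : bool) {m p : nat} (X : 'M[R]_(m, p)) (pi : R)
  (j : 'I_p) (y : 'cV[R]_m) : R :=
  (rescale b X pi j y)^-1 * ((Xstar X pi j)^T *m y) 0 0.

Definition supp {p : nat} (beta : 'cV[R]_p) : {set 'I_p} :=
  [set j | beta j 0 != 0].

End LinearModel.

Section Noise.
Context {R : realType} {d : measure_display} {T : measurableType d}.

(* e_1, ..., e_m are i.i.d. N(0, s^2) (s = standard deviation) under P:
   measurable, each with law normal_prob 0 s, and mutually independent
   (product rule over every subfamily).  If s = 0 the noise is identically 0. *)
Definition iid_gaussian (P : probability T R) {m : nat} (e : 'I_m -> T -> R)
  (s : R) : Prop :=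
  if s == 0 then forall i t, e i t = 0 else
  [/\ (forall i, measurable_fun setT (e i)),
      (forall i (B : set R), measurable B ->
          P (e i @^-1` B) = normal_prob 0 s B) &
      (forall (I : {set 'I_m}) (B : 'I_m -> set R),
          (forall i, measurable (B i)) ->
          P (\big[setI/setT]_(i in I) (e i @^-1` B i)) =
          (\prod_(i in I) P (e i @^-1` B i))%E)].

End Noise.

Definition response {R : realType} {T : Type} {m p : nat} (X : 'M[R]_(m, p))
  (beta : 'cV[R]_p) (eps : 'I_m -> T -> R) (t : T) : 'cV[R]_m :=
  X *m beta + \col_i eps i t.

(* Main.v *)
Require Import Defs.
From HB Require Import structures.
From mathcomp Require Import all_boot all_order all_algebra.
From mathcomp Require Import all_classical all_reals all_analysis.
From mathcomp Require Import measurable_realfun normal_distribution ring lra.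
Import Order.TTheory GRing.Theory Num.Theory.
Import numFieldNormedType.Exports.
Local Open Scope classical_set_scope.
Local Open Scope ring_scope.

(* On the event that the noise [e] satisfies [|<v, e>| <= n^-gamma |v|] for at
   most exponentially many (in [n^theta]) fixed vectors [v], namely [X_k^*],
   [(I - Pi_k) X beta] and an orthonormal basis of the range of each [Pi_k], and
   that [sigma^2 / 3 <= |e|^2 <= 4 sigma^2], the theorem is deterministic: since
   [X_k^*] is orthogonal to [X_j] for [j] in [C_k], and has inner product
   [O(n^-gamma)] with the other [X_j], [j] in [S] and [j <> k],
     [<X_k^*, y> = beta_k lambda_k + O(n^(delta - gamma))] uniformly in [k].
   Dividing by [lambda_k > alpha] settles the first rescaling.  For the second
   one, [1 - a_ky = |(I - Pi_k) y|^2 / |y|^2 <= 1] suffices on [S]; off [S] it is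
   bounded below by [n^-kappa] up to a constant if [S] is not contained in [C_k]
   (A6), and otherwise [<X_k^*, y>] is pure noise and the ratio is at least of
   order [n^(-2 delta)] because [|(I - Pi_k) e|] stays away from 0.
   The good event has probability tending to 1 by Chernoff's bound for linear
   and quadratic functions of independent Gaussians and a union bound. *)

(** * Weighted integrals: from indicators to nonnegative functions *)

Section WeightedIntegral.
Import HBNNSimple.
Local Open Scope ereal_scope.

Lemma cvg_weighted_integral {d d'} {T : measurableType d}
    {Y : measurableType d'} {R : realType} (mu : {measure set T -> \bar R})
    (X : T -> Y) (W : T -> \bar R) (h : nat -> Y -> R) (g : Y -> R) :
  measurable_fun setT X -> measurable_fun setT W -> (forall t, 0 <= W t) ->
  (forall n, measurable_fun setT (h n)) -> (forall n y, (0 <= h n y)%R) ->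
  (forall y n m, (n <= m)%N -> (h n y <= h m y)%R) ->
  (forall y, (h n y)%:E @[n --> \oo] --> (g y)%:E) ->
  \int[mu]_t ((h n (X t))%:E * W t) @[n --> \oo] -->
  \int[mu]_t ((g (X t))%:E * W t).
Proof.
move=> mX mW W0 hm h0 hnd hcvg.
rewrite (_ : \int[mu]_t ((g (X t))%:E * W t) =
   \int[mu]_t (limn ((fun n t => (h n (X t))%:E * W t) ^~ t))).
  apply: cvg_monotone_convergence => //.
  - move=> n; apply: emeasurable_funM => //.
    by apply/measurable_EFinP; exact: measurableT_comp.
  - by move=> n t _; rewrite mule_ge0// lee_fin.
  - by move=> t _ n m nm; rewrite lee_wpmul2r// lee_fin hnd.
apply: eq_integral => t _; apply/esym/cvg_lim => //.
(* [W t] may be infinite. Where [g] vanishes, monotonicity forces every [h n] to vanish, so all the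
   products are 0; elsewhere the product of the limits is well defined. *)
have [g0'|g0'] := eqVneq (g (X t)) 0%R.
  have hz n : h n (X t) = 0%R.
    apply/le_anti/andP; split => //; rewrite -g0' -lee_fin.
    apply: (cvge_ge _ (hcvg (X t))); near=> k.
    by rewrite lee_fin hnd//; near: k; exact: nbhs_infty_ge.
  under eq_fun do rewrite hz mul0e.
  by rewrite g0' mul0e; exact: cvg_cst.
apply: cvgeM; [|exact: hcvg|exact: cvg_cst].
case: (W t) => [r||].
- exact: mule_def_fin.
- exact: mule_def_neq0_infty.
- exact: mule_def_neq0_infty.
Unshelve. all: by end_near. Qed.

(** A simple function is a finite sum of values times indicators of fibres, so an identity tested on
    indicators passes to simple functions. *)
Lemma weighted_integral_nnsfun {d d'} {T : measurableType d}
    {Y : measurableType d'} {R : realType} (mu : {measure set T -> \bar R})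
    (X : T -> Y) (W : T -> \bar R) (h : {nnsfun Y >-> R}) :
  measurable_fun setT X -> measurable_fun setT W -> (forall t, 0 <= W t) ->
  \int[mu]_t ((h (X t))%:E * W t) =
  \sum_(y \in range h) (y%:E *
       \int[mu]_t ((\1_(h @^-1` [set y]) (X t))%:E * W t)).
Proof.
move=> mX mW W0.
have mi y : measurable_fun setT (fun t => (\1_(h @^-1` [set y]) (X t))%:E * W t).
  apply: emeasurable_funM => //; apply/measurable_EFinP.
  by apply: measurableT_comp => //; apply: measurable_indic.
(* A negative [y] has an empty fibre, since [h] is nonnegative. *)
have term_ge0 y t : 0 <= y%:E * ((\1_(h @^-1` [set y]) (X t))%:E * W t).
  rewrite indicE; case: (boolP (_ \in _)) => [|_]; last by rewrite mul0e mule0.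
  by rewrite inE /= => <-; rewrite mul1e mule_ge0 ?lee_fin.
transitivity (\int[mu]_t \sum_(y \in range h)
    (y%:E * ((\1_(h @^-1` [set y]) (X t))%:E * W t))).
  apply: eq_integral => t _.
  rewrite (fsbigD1 (h (X t))) //=; [|by exists (X t)].
  rewrite fsbig1 ?adde0; last first.
    move=> y [_ /= /eqP yh]; rewrite indicE memNset ?mul0e ?mule0//=.
    by move=> e; move: yh; rewrite e eqxx.
  by rewrite indicE mem_set//= mul1e.
rewrite ge0_integral_fsum //; [|by move=> y; exact: emeasurable_funM].
apply: eq_fsbigr => y; rewrite inE => -[z _ <-].
rewrite ge0_integralZl_EFin//.
by move=> t _; rewrite mule_ge0 // lee_fin.
Qed.

(** Approximation by simple functions and monotone convergence on both sides. The weights allow two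
    uses: a density on one side only, and the product of the remaining factors in an expectation of
    independent variables. *)
Lemma weighted_integral_ext {d1 d2 d} {T1 : measurableType d1}
    {T2 : measurableType d2} {Y : measurableType d} {R : realType}
    (m1 : {measure set T1 -> \bar R}) (m2 : {measure set T2 -> \bar R})
    (X1 : T1 -> Y) (X2 : T2 -> Y) (W1 : T1 -> \bar R) (W2 : T2 -> \bar R) :
  measurable_fun setT X1 -> measurable_fun setT X2 ->
  measurable_fun setT W1 -> measurable_fun setT W2 ->
  (forall t, 0 <= W1 t) -> (forall t, 0 <= W2 t) ->
  (forall B, measurable B -> \int[m1]_t ((\1_B (X1 t))%:E * W1 t) =
                             \int[m2]_t ((\1_B (X2 t))%:E * W2 t)) ->
  forall g : Y -> R, measurable_fun setT g -> (forall y, (0 <= g y)%R) ->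
  \int[m1]_t ((g (X1 t))%:E * W1 t) = \int[m2]_t ((g (X2 t))%:E * W2 t).
Proof.
move=> mX1 mX2 mW1 mW2 W10 W20 H12 g mg g0.
have mEg : measurable_fun setT (EFin \o g) by exact/measurable_EFinP.
pose h := nnsfun_approx measurableT mEg.
have hcvg y : (h n y)%:E @[n --> \oo] --> (g y)%:E.
  by apply: (cvg_nnsfun_approx measurableT mEg) => // z _ /=; rewrite lee_fin.
have hnd y n m : (n <= m)%N -> (h n y <= h m y)%R.
  by move=> nm; exact/lefP/nd_nnsfun_approx.
have c1 := cvg_weighted_integral m1 X1 W1 h g mX1 mW1 W10
  (fun n => measurable_funPT (h n)) (fun n y => fun_ge0 y) hnd hcvg.
have c2 := cvg_weighted_integral m2 X2 W2 h g mX2 mW2 W20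
  (fun n => measurable_funPT (h n)) (fun n y => fun_ge0 y) hnd hcvg.
apply: (cvg_unique _ c1); first exact: ereal_hausdorff.
rewrite (_ : (fun n => _) = (fun n => \int[m2]_t ((h n (X2 t))%:E * W2 t))) //.
apply/funext => n; rewrite !weighted_integral_nnsfun//.
by apply: eq_fsbigr => y _; rewrite H12.
Qed.
End WeightedIntegral.

(** * Expectations under independence and under a Gaussian law *)

Section Independence.
Context {R : realType} {d : measure_display} {T : measurableType d}.
Variable P : probability T R.
Local Open Scope ereal_scope.

Lemma indep_integral_prod (m : nat) (e : 'I_m -> T -> R) (f : 'I_m -> R -> R) :
  (forall i, measurable_fun setT (e i)) ->
  (forall B : 'I_m -> set R, (forall i, measurable (B i)) ->
     P (\big[setI/setT]_i (e i @^-1` B i)) = \prod_i P (e i @^-1` B i)) ->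
  (forall i, measurable_fun setT (f i)) -> (forall i x, (0 <= f i x)%R) ->
  \int[P]_t (\prod_i f i (e i t))%:E = \prod_i \int[P]_t (f i (e i t))%:E.
Proof.
move=> me indep.
(* replace the indicators by arbitrary functions one coordinate at a time *)
suff claim k : forall f : 'I_m -> R -> R,
    (forall i, measurable_fun setT (f i)) -> (forall i x, (0 <= f i x)%R) ->
    (forall i : 'I_m, (k <= i)%N -> exists2 B, measurable B & f i = \1_B) ->
    \int[P]_t (\prod_i f i (e i t))%:E = \prod_i \int[P]_t (f i (e i t))%:E.
  move=> mf f0; apply: (claim m) => // i.
  by rewrite leqNgt ltn_ord.
elim: k => [|k IH] {}f mf f0 fB.
  have /choice [B HB] : forall i, exists B, measurable B /\ f i = \1_B.
    by move=> i; have [B ? ?] := fB i isT; exists B.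
  have mB i : measurable (B i) by case: (HB i).
  have fE i : f i = \1_(B i) by case: (HB i).
  have mI i : measurable (e i @^-1` B i).
    by rewrite -[X in measurable X]setTI; exact: me.
  transitivity (P (\big[setI/setT]_i (e i @^-1` B i))).
    have mJ : measurable (\big[setI/setT]_i (e i @^-1` B i)).
      by apply: bigsetI_measurable => i _.
    rewrite -[in RHS](setIT (\big[setI/setT]_i _)).
    rewrite -(@integral_indic _ _ _ P setT measurableT _ mJ).
    apply: eq_integral => t _; congr EFin.
    under eq_bigr do rewrite fE.
    rewrite indicE.
    case: (boolP (t \in _)) => [|/negP].
      rewrite inE -bigcap_seq => tB; rewrite big1// => i _.
      by rewrite indicE mem_set//; exact: (tB i (mem_index_enum i)).
    rewrite inE -bigcap_seq => /existsNP[i /not_implyP[_ ti]].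
    by rewrite (bigD1 i)//= indicE memNset ?mul0r.
  rewrite indep//; apply: eq_bigr => i _.
  by rewrite fE (@integral_indic _ _ _ P setT measurableT _ (mI i)) setIT.
case: (ltnP k m) => [km|mk]; last first.
  by apply: IH => // i ki; exfalso; move: (leq_trans mk ki); rewrite leqNgt ltn_ord.
pose i0 := Ordinal km.
have mfe i : measurable_fun setT (fun t => f i (e i t)).
  exact: measurableT_comp.
pose c := \prod_(i < m | i != i0) \int[P]_t (f i (e i t))%:E.
have c0 : 0 <= c.
  by apply: prode_ge0 => i _; apply: integral_ge0 => t _; rewrite lee_fin.
pose W t := (\prod_(i < m | i != i0) f i (e i t))%:E.
have W0 t : 0 <= W t by rewrite lee_fin prodr_ge0.
have mW : measurable_fun setT W.
  apply/measurable_EFinP.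
  under eq_fun do rewrite -big_filter.
  by apply: measurable_prod => i _.
transitivity (\int[P]_t ((f i0 (e i0 t))%:E * W t)).
  by apply: eq_integral => t _; rewrite (bigD1 i0)//= EFinM.
transitivity (\int[P]_t ((f i0 (e i0 t))%:E * c)); last first.
  under eq_integral do rewrite muleC.
  rewrite ge0_integralZl//; last 2 first.
  - exact/measurable_EFinP.
  - by move=> t _; rewrite lee_fin.
  by rewrite [in RHS](bigD1 i0)//= muleC.
(* It remains to test coordinate [i0] on indicators: with [f i0] replaced by [\1_B], the family has
   indicators from index [k] on and the induction hypothesis applies. *)
apply: (weighted_integral_ext P P (e i0) (e i0) W (cst c)) => //.
move=> B mB.
pose f' i := if i == i0 then \1_B else f i.
have f'0 : f' i0 = \1_B by rewrite /f' eqxx.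
have f'N i : i != i0 -> f' i = f i by rewrite /f' => /negbTE ->.
have : \int[P]_t (\prod_i f' i (e i t))%:E = \prod_i \int[P]_t (f' i (e i t))%:E.
  apply: IH => [i|i x|i ki].
  - by rewrite /f'; case: eqP => // _; exact: measurable_indic.
  - by rewrite /f'; case: eqP.
  - have [->|ii0] := eqVneq i i0; first by exists B.
    rewrite f'N//; apply: fB.
    by rewrite ltn_neqAle ki andbT; apply: contra ii0 => /eqP ki0; apply/eqP/val_inj.
rewrite [in RHS](bigD1 i0)//= f'0.
under [in RHS]eq_bigr => i ii0 do rewrite f'N//.
rewrite -/c muleC => H.
transitivity (\int[P]_t (\prod_i f' i (e i t))%:E).
  apply: eq_integral => t _; rewrite (bigD1 i0)//= f'0 -EFinM /W.
  by congr (_ * _)%:E; apply: eq_bigr => i ii0; rewrite f'N.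
rewrite H; under [in RHS]eq_integral do rewrite muleC.
rewrite ge0_integralZl//.
by apply/measurable_EFinP; apply: measurableT_comp => //; exact: measurable_indic.
Qed.

Lemma gaussian_expectation (X : T -> R) (s : R) (g : R -> R) :
  measurable_fun setT X ->
  (forall B : set R, measurable B -> P (X @^-1` B) = normal_prob 0 s B) ->
  measurable_fun setT g -> (forall x, (0 <= g x)%R) ->
  \int[P]_t (g (X t))%:E =
  \int[lebesgue_measure]_x (g x * normal_pdf 0 s x)%:E.
Proof.
move=> mX lawX mg g0.
transitivity (\int[P]_t ((g (X t))%:E * 1)).
  by apply: eq_integral => t _; rewrite mule1.
have mpdf : measurable_fun setT (fun x => (normal_pdf 0 s x)%:E).
  by apply/measurable_EFinP; exact: measurable_normal_pdf.
under [in RHS]eq_integral do rewrite EFinM.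
apply: (weighted_integral_ext P lebesgue_measure X id (cst 1)
  (fun x => (normal_pdf 0 s x)%:E)) => //.
  by move=> x; rewrite lee_fin normal_pdf_ge0.
move=> B mB.
have mXB : measurable (X @^-1` B).
  by rewrite -[X in measurable X]setTI; exact: mX.
transitivity (P (X @^-1` B)).
  under eq_integral do rewrite mule1.
  by rewrite (@integral_indic _ _ _ P setT measurableT _ mXB) setIT.
rewrite lawX// /normal_prob [LHS]integral_mkcond; apply: eq_integral => x _.
by rewrite patchE indicE; case: (x \in B); rewrite ?mul1e ?mul0e.
Qed.
End Independence.

(** * Exponential moments of linear and quadratic functions of a Gaussian *)

Section GaussianTransforms.
Context {R : realType}.

(** Completing the square turns the integrand into a constant times the density of N([a s^2],
    [s^2]). *)
Lemma integral_expR_linear_normal (s a : R) : s != 0 ->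
  (\int[lebesgue_measure]_x (expR (a * x) * normal_pdf 0 s x)%:E =
   (expR (a ^+ 2 * s ^+ 2 / 2))%:E)%E.
Proof.
move=> s0.
transitivity (\int[lebesgue_measure]_x
    ((expR (a ^+ 2 * s ^+ 2 / 2))%:E * (normal_pdf (a * s ^+ 2) s x)%:E))%E.
  apply: eq_integral => x _; rewrite -EFinM; congr EFin.
  rewrite !normal_pdfE// mulrCA [RHS]mulrCA; congr (_ * _).
  rewrite /normal_fun -!expRD; congr expR.
  by field.
rewrite ge0_integralZl_EFin ?integral_normal_pdf ?mule1//.
- by move=> x _; rewrite lee_fin normal_pdf_ge0.
- by apply/measurable_EFinP; exact: measurable_normal_pdf.
Qed.

(** The exponents add up to that of N(0, [s'^2]), and [s' / s] is the ratio of the normalizing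
    constants. Taking [s'] as the parameter covers both signs of [c]. *)
Lemma integral_expR_square_normal (s s' c : R) : 0 < s -> 0 < s' ->
  c = (2 * s ^+ 2)^-1 - (2 * s' ^+ 2)^-1 ->
  (\int[lebesgue_measure]_x (expR (c * x ^+ 2) * normal_pdf 0 s x)%:E =
   (s' / s)%:E)%E.
Proof.
move=> s0 s'0 ->.
transitivity (\int[lebesgue_measure]_x
    ((s' / s)%:E * (normal_pdf 0 s' x)%:E))%E.
  apply: eq_integral => x _; rewrite -EFinM; congr EFin.
  rewrite !normal_pdfE ?gt_eqF//.
  have peakE (u : R) : 0 < u -> normal_peak u = u^-1 * (Num.sqrt (pi * 2))^-1.
    move=> u0; rewrite /normal_peak -mulrnAr sqrtrM ?sqr_ge0// sqrtr_sqr.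
    by rewrite gtr0_norm// invfM mulr_natr.
  rewrite !peakE// /normal_fun [LHS]mulrCA; set q := (Num.sqrt _)^-1.
  rewrite -expRD.
  have -> : ((2 * s ^+ 2)^-1 - (2 * s' ^+ 2)^-1) * x ^+ 2 +
     - (x - 0) ^+ 2 / (s ^+ 2 *+ 2) = - (x - 0) ^+ 2 / (s' ^+ 2 *+ 2).
    by field; rewrite !gt_eqF.
  by field; rewrite !gt_eqF.
rewrite ge0_integralZl_EFin ?integral_normal_pdf ?mule1//.
- by move=> x _; rewrite lee_fin normal_pdf_ge0.
- by apply/measurable_EFinP; exact: measurable_normal_pdf.
- by rewrite divr_ge0 ?ltW.
Qed.
End GaussianTransforms.

(** * Chernoff bounds for linear forms and for the squared norm of the noise *)

Section GaussianTails.
Context {R : realType} {d : measure_display} {T : measurableType d}.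
Variable P : probability T R.

Lemma measurable_superlevel (f : T -> R) (a : R) : measurable_fun setT f ->
  measurable [set t | a <= f t].
Proof.
move=> mf; rewrite (_ : [set t | _] = setT `&` f @^-1` `[a, +oo[).
  exact: mf.
by apply/seteqP; split => t /=; rewrite in_itv/= andbT => // -[].
Qed.

Lemma measurable_strict_superlevel (f : T -> R) (a : R) :
  measurable_fun setT f -> measurable [set t | a < f t].
Proof.
move=> mf; rewrite (_ : [set t | _] = setT `&` f @^-1` `]a, +oo[).
  exact: mf.
by apply/seteqP; split => t /=; rewrite in_itv/= andbT => // -[].
Qed.

Lemma measurable_sublevel (f : T -> R) (a : R) : measurable_fun setT f ->
  measurable [set t | f t <= a].
Proof.
move=> mf; rewrite (_ : [set t | _] = setT `&` f @^-1` `]-oo, a]).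
  exact: mf.
by apply/seteqP; split => t /=; rewrite in_itv/= => // -[].
Qed.

Lemma markov_expR (Z : T -> R) (a : R) : measurable_fun setT Z ->
  (P [set t | (a <= Z t)%R] <= (expR (- a))%:E * \int[P]_t (expR (Z t))%:E)%E.
Proof.
move=> mZ.
have mA : measurable [set t | a <= Z t] by exact: measurable_superlevel.
have mE : measurable_fun setT (fun t => (expR (Z t))%:E).
  by apply/measurable_EFinP; apply: measurableT_comp.
rewrite -[X in (P X)]setIT -(@integral_indic _ _ _ P setT measurableT _ mA).
rewrite -ge0_integralZl_EFin ?expR_ge0//.
apply: ge0_le_integral => //.
- by apply/measurable_EFinP; exact: measurable_indic.
- by apply: emeasurable_funM.
- move=> t _; rewrite -EFinM -expRD lee_fin indicE.
  case: (boolP (t \in _)) => [|_]; last exact: expR_ge0.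
  rewrite inE /= => at_; rewrite -expR0 ler_expR.
  by rewrite addrC subr_ge0.
Qed.

Context {m : nat} (e : 'I_m -> T -> R) (s : R).
Hypothesis s0 : 0 < s.
Hypothesis He : iid_gaussian P e s.

Let He' : [/\ (forall i, measurable_fun setT (e i)),
      (forall i (B : set R), measurable B ->
          P (e i @^-1` B) = normal_prob 0 s B) &
      (forall (I : {set 'I_m}) (B : 'I_m -> set R),
          (forall i, measurable (B i)) ->
          P (\big[setI/setT]_(i in I) (e i @^-1` B i)) =
          (\prod_(i in I) P (e i @^-1` B i))%E)].
Proof. by move: He; rewrite /iid_gaussian gt_eqF. Qed.

Lemma iid_gaussian_measurable i : measurable_fun setT (e i).
Proof. by case: He'. Qed.

(** Markov's inequality for the exponential of the sum, whose expectation factorizes by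
    independence. Leaving [h] general serves the linear and the quadratic tails alike. *)
Lemma gaussian_chernoff (h : 'I_m -> R -> R) (M : 'I_m -> R) (a : R) :
  (forall i, measurable_fun setT (h i)) ->
  (forall i, (\int[lebesgue_measure]_x (expR (h i x) * normal_pdf 0 s x)%:E =
    (M i)%:E)%E) ->
  (P [set t | (a <= \sum_i h i (e i t))%R] <= (expR (- a) * \prod_i M i)%:E)%E.
Proof.
move=> mh hM; case: He' => me lawe inde.
have mS : measurable_fun setT (fun t => \sum_i h i (e i t)).
  by apply: measurable_sum => i; apply: measurableT_comp.
apply: le_trans (markov_expR _ a mS) _.
rewrite EFinM lee_pmul2l ?lte_fin ?expR_gt0//.
under eq_integral do rewrite expR_sum.
have indeT (B : 'I_m -> set R) : (forall i, measurable (B i)) ->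
    P (\big[setI/setT]_i (e i @^-1` B i)) = (\prod_i P (e i @^-1` B i))%E.
  move=> mB; have := inde [set: 'I_m]%SET B mB.
  by under eq_bigl do rewrite inE; under [in RHS]eq_bigl do rewrite inE.
rewrite (@indep_integral_prod _ _ _ P m e (fun i x => expR (h i x)))//; last first.
  by move=> i; apply: measurableT_comp.
rewrite -prodEFin le_eqVlt; apply/orP; left; apply/eqP.
apply: eq_bigr => i _; rewrite -hM.
apply: (@gaussian_expectation _ _ _ P (e i) s (fun x => expR (h i x))).
- exact: me.
- exact: lawe.
- exact: measurableT_comp.
- by move=> x; exact: expR_ge0.
Qed.

Lemma gaussian_linear_tail1 (v : 'I_m -> R) (tau : R) : 0 < tau ->
  0 < \sum_i v i ^+ 2 ->
  (P [set t | (tau * Num.sqrt (\sum_i v i ^+ 2) <= \sum_i v i * e i t)%R] <=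
   (expR (- (tau ^+ 2 / (2 * s ^+ 2))))%:E)%E.
Proof.
move=> tau0; set V := \sum_i _ => V0.
(* The Chernoff parameter that minimizes the exponent [l^2 V s^2 / 2 - l tau sqrt V]. *)
pose l := tau / (s ^+ 2 * Num.sqrt V).
have sV0 : 0 < Num.sqrt V by rewrite sqrtr_gt0.
have l0 : 0 < l by rewrite divr_gt0// mulr_gt0// exprn_gt0.
have -> : [set t | tau * Num.sqrt V <= \sum_i v i * e i t] =
          [set t | tau ^+ 2 / s ^+ 2 <= \sum_i (l * v i) * e i t].
  apply/funext => t /=; apply/propext.
  have -> : tau ^+ 2 / s ^+ 2 = l * (tau * Num.sqrt V).
    by rewrite /l; field; rewrite !gt_eqF.
  under [in X in _ <-> X]eq_bigr do rewrite -mulrA.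
  by rewrite -mulr_sumr ler_pM2l.
apply: le_trans (gaussian_chernoff (fun i x => l * v i * x)
  (fun i => expR ((l * v i) ^+ 2 * s ^+ 2 / 2)) _ _ _) _.
- by move=> i; exact: measurable_funM.
- by move=> i; by apply: integral_expR_linear_normal; rewrite gt_eqF.
rewrite -expR_sum -expRD lee_fin ler_expR.
have -> : \sum_i (l * v i) ^+ 2 * s ^+ 2 / 2 = l ^+ 2 * (V * (s ^+ 2 / 2)).
  by rewrite [V * _]mulr_suml mulr_sumr; apply: eq_bigr => i _; ring.
have -> : l ^+ 2 * (V * (s ^+ 2 / 2)) = tau ^+ 2 / (2 * s ^+ 2).
  rewrite -[V in V * (_ / _)]sqr_sqrtr ?ltW// /l; field; by rewrite !gt_eqF.
by rewrite le_eqVlt; apply/orP; left; apply/eqP; field; rewrite gt_eqF.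
Qed.

Lemma measurable_linear (v : 'I_m -> R) :
  measurable_fun setT (fun t => \sum_i v i * e i t).
Proof.
apply: measurable_sum => i; apply: measurable_funM => //.
exact: iid_gaussian_measurable.
Qed.

Lemma gaussian_linear_tail (v : 'I_m -> R) (tau : R) : 0 < tau ->
  (P [set t | (tau * Num.sqrt (\sum_i v i ^+ 2) < `|\sum_i v i * e i t|)%R] <=
   (2 * expR (- (tau ^+ 2 / (2 * s ^+ 2))))%:E)%E.
Proof.
move=> tau0.
(* For [v = 0] the event is empty because its inequality is strict. *)
have [V0|V0] := eqVneq (\sum_i v i ^+ 2) 0.
  rewrite (_ : [set _ | _] = set0) ?measure0 ?lee_fin ?mulr_ge0 ?expR_ge0//.
  rewrite -subset0 => t /=; rewrite V0 sqrtr0 mulr0 big1 ?normr0 ?ltxx// => i _.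
  have /eqP := V0; rewrite psumr_eq0 => [/allP/(_ i)|j _]; last exact: sqr_ge0.
  by rewrite mem_index_enum sqrf_eq0 => /(_ isT)/eqP ->; rewrite mul0r.
have {}V0 : 0 < \sum_i v i ^+ 2.
  by rewrite lt_neqAle eq_sym V0 sumr_ge0// => i _; exact: sqr_ge0.
set c := tau * _.
have mS := measurable_linear.
have mA (w : 'I_m -> R) : measurable [set t | (c <= \sum_i w i * e i t)%R].
  exact: measurable_superlevel.
apply: (@le_trans _ _ (P ([set t | (c <= \sum_i v i * e i t)%R] `|`
   [set t | (c <= \sum_i (- v i) * e i t)%R]))).
  apply: le_measure; rewrite ?inE; [|exact: measurableU|].
    by apply: measurable_strict_superlevel; apply: measurableT_comp.
  move=> t /=; under [in X in _ -> _ \/ X]eq_bigr do rewrite mulNr.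
  rewrite sumrN ltr_normr.
  by case/orP => /ltW; [left|right].
apply: le_trans (measureU2 _ _ _) _ => //.
rewrite mulr_natl mulr2n EFinD leeD//; first exact: gaussian_linear_tail1.
have VN : \sum_i (- v i) ^+ 2 = \sum_i v i ^+ 2.
  by apply: eq_bigr => i _; rewrite sqrrN.
by rewrite /c -VN; apply: gaussian_linear_tail1; rewrite ?VN.
Qed.

(* [exp (3 x^2 / (8 s^2))] times the N(0, s^2) density is twice the
   N(0, (2 s)^2) density; below, [exp (- 3 x^2 / (2 s^2))] similarly gives half
   of the N(0, (s / 2)^2) density. *)
Lemma gaussian_sqnorm_upper :
  (P [set t | (4 * m%:R * s ^+ 2 <= \sum_i (e i t) ^+ 2)%R] <=
   ((2 * expR (- (3 / 2))) ^+ m)%:E)%E.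
Proof.
have c0 : 0 < 3 / (8 * s ^+ 2) by rewrite divr_gt0 ?mulr_gt0 ?exprn_gt0.
have -> : [set t | 4 * m%:R * s ^+ 2 <= \sum_i (e i t) ^+ 2] =
   [set t | 3 / 2 * m%:R <= \sum_i (3 / (8 * s ^+ 2)) * (e i t) ^+ 2].
  apply/funext => t /=; apply/propext.
  have -> : 3 / 2 * m%:R = 3 / (8 * s ^+ 2) * (4 * m%:R * s ^+ 2).
    by field; rewrite gt_eqF.
  by rewrite -mulr_sumr ler_pM2l.
apply: le_trans (gaussian_chernoff (fun i x => 3 / (8 * s ^+ 2) * x ^+ 2)
  (fun i => 2) _ _ _) _.
- by move=> i; apply: measurable_funM => //; exact: measurable_funX.
- move=> i; rewrite (@integral_expR_square_normal _ s (2 * s)) ?mulr_gt0//.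
    by rewrite mulfK// gt_eqF.
  by field; rewrite gt_eqF.
rewrite prodr_const card_ord lee_fin exprMn mulrC -expRM_natl.
have -> : - (3 / 2 * m%:R) = m%:R * - (3 / 2) :> R by ring.
by [].
Qed.

Lemma gaussian_sqnorm_lower :
  (P [set t | (\sum_i (e i t) ^+ 2 <= m%:R * s ^+ 2 / 3)%R] <=
   ((expR (1 / 2) / 2) ^+ m)%:E)%E.
Proof.
have c0 : 0 < 3 / (2 * s ^+ 2) by rewrite divr_gt0 ?mulr_gt0 ?exprn_gt0.
have -> : [set t | \sum_i (e i t) ^+ 2 <= m%:R * s ^+ 2 / 3] =
   [set t | - (1 / 2 * m%:R) <= \sum_i (- (3 / (2 * s ^+ 2))) * (e i t) ^+ 2].
  apply/funext => t /=; apply/propext.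
  have -> : 1 / 2 * m%:R = 3 / (2 * s ^+ 2) * (m%:R * s ^+ 2 / 3).
    by field; rewrite gt_eqF.
  by rewrite -mulr_sumr mulNr lerN2 ler_pM2l.
apply: le_trans (gaussian_chernoff (fun i x => - (3 / (2 * s ^+ 2)) * x ^+ 2)
  (fun i => 2^-1) _ _ _) _.
- by move=> i; apply: measurable_funM => //; exact: measurable_funX.
- move=> i; rewrite (@integral_expR_square_normal _ s (s / 2)) ?divr_gt0//.
    by rewrite mulrAC divff ?mul1r// gt_eqF.
  by field; rewrite gt_eqF.
rewrite prodr_const card_ord lee_fin exprMn opprK -expRM_natl.
by rewrite [1 / 2 * _]mulrC.
Qed.
End GaussianTails.

(** * Inner products and orthogonal projections *)

Section OrthogonalProjection.
Context {R : realType} {m : nat}.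
Implicit Types u v w : 'cV[R]_m.

Definition dotp u v : R := (u^T *m v) 0 0.

Lemma dotpE u v : dotp u v = \sum_i u i 0 * v i 0.
Proof. by rewrite /dotp mxE; apply: eq_bigr => i _; rewrite mxE. Qed.

Lemma dotpC u v : dotp u v = dotp v u.
Proof. by rewrite !dotpE; apply: eq_bigr => i _; rewrite mulrC. Qed.

Lemma dotpDr u v w : dotp u (v + w) = dotp u v + dotp u w.
Proof. by rewrite /dotp mulmxDr mxE. Qed.

Lemma dotpDl u v w : dotp (u + v) w = dotp u w + dotp v w.
Proof. by rewrite dotpC dotpDr !(dotpC w). Qed.

Lemma dotpBl u v w : dotp (u - v) w = dotp u w - dotp v w.
Proof. by rewrite /dotp linearB /= mulmxBl mxE [X in _ + X]mxE. Qed.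

Lemma sqnorm_dotp u : sqnorm u = dotp u u.
Proof. by rewrite dotpE; apply: eq_bigr => i _; rewrite expr2. Qed.

Lemma sqnorm_ge0 u : 0 <= sqnorm u.
Proof. by apply: sumr_ge0 => i _; exact: sqr_ge0. Qed.

Lemma sqnorm_eq0 u : (sqnorm u == 0) = (u == 0).
Proof.
apply/idP/eqP => [|->]; last first.
  by rewrite /sqnorm big1// => i _; rewrite mxE expr0n.
rewrite psumr_eq0 => [/allP u0|i _]; last exact: sqr_ge0.
apply/matrixP => i j; rewrite ord1 mxE; apply/eqP.
by have := u0 i (mem_index_enum i); rewrite sqrf_eq0.
Qed.

Lemma sqnormD u v : sqnorm (u + v) = sqnorm u + 2 * dotp u v + sqnorm v.
Proof.
by rewrite !sqnorm_dotp dotpDl !dotpDr (dotpC v u); ring.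
Qed.

Lemma sqnormD_le u v : sqnorm (u + v) <= 2 * sqnorm u + 2 * sqnorm v.
Proof.
rewrite /sqnorm !mulr_sumr -big_split; apply: ler_sum => i _ /=.
rewrite mxE; have := sqr_ge0 (u i 0 - v i 0); nra.
Qed.

Lemma dotp_mull (A : 'M[R]_m) u v : dotp (A *m u) v = dotp u (A^T *m v).
Proof. by rewrite /dotp trmx_mul mulmxA. Qed.

Lemma dotp_outer u v w : dotp v (u *m u^T *m w) = dotp v u * dotp u w.
Proof.
by rewrite /dotp -mulmxA mulmxA mxE big_ord1.
Qed.

(** Equal row spaces give [A B = A] and [B A = B]; transposing the first and using symmetry gives
    [B A = A]. *)
Lemma is_orthproj_uniq {q : nat} (U : 'M[R]_(q, m)) (A B : 'M[R]_m) :
  is_orthproj U A -> is_orthproj U B -> A = B.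
Proof.
have subm (C D : 'M[R]_m) : is_orthproj U C -> is_orthproj U D -> C *m D = C.
  case=> _ _ /eqmxP CU [_ DD /eqmxP DU].
  have /submxP[M ->] : (C <= D)%MS by rewrite CU DU.
  by rewrite -mulmxA DD.
move=> PA PB; have AB := subm _ _ PA PB; have BA := subm _ _ PB PA.
case: PA PB => tA _ _ [tB _ _].
by rewrite -[LHS]tA -AB trmx_mul tA tB.
Qed.

Lemma row_span_mx {p : nat} (X : 'M[R]_(m, p)) (A : {set 'I_p}) (k : 'I_p) :
  row k (span_mx X A) = if k \in A then (col k X)^T else 0.
Proof.
by apply/rowP => i; rewrite !mxE; case: ifP => _; rewrite !mxE.
Qed.

(* Gram-Schmidt: adding [k] to [A] adds the rank one projection onto the
   residual of [col k X], which vanishes if [col k X] is already in the span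
   (hence [sqnorm (u k) <= 1] and not [= 1]). *)
Lemma orthproj_exists {p : nat} (X : 'M[R]_(m, p)) (A : {set 'I_p}) :
  exists u : 'I_p -> 'cV[R]_m,
    [/\ forall k, sqnorm (u k) <= 1,
        forall k, k \notin A -> u k = 0 &
        is_orthproj (span_mx X A) (\sum_k u k *m (u k)^T)].
Proof.
elim: {A}#|A| {-2}A (erefl #|A|) => [|n IH] A cA.
  exists (fun=> 0); split => // [k|].
    by rewrite (eqP (_ : sqnorm 0 == 0)) ?sqnorm_eq0.
  rewrite big1 => [|k _]; last by rewrite mul0mx.
  split; rewrite ?trmx0 ?mulmx0//.
  apply/eqmxP; rewrite (_ : span_mx X A = 0); first by apply: eqmx_sym; exact: eqmx0.
  move/eqP: cA; rewrite cards_eq0 => /eqP ->.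
  by apply/matrixP => i j; rewrite !mxE inE.
have /card_gt0P[k kA] : (0 < #|A|)%N by rewrite cA.
have cB : #|A :\ k| = n by apply/eqP; rewrite -eqSS -cA (cardsD1 k A) kA.
have [u [u1 uB]] := IH _ cB; set Q := \sum_k _ => -[tQ QQ /eqmxP QU].
pose x := col k X; pose w := x - Q *m x.
have Qw : Q *m w = 0 by rewrite mulmxBr mulmxA QQ subrr.
have wQ : w^T *m Q = 0 by rewrite -[LHS]trmxK trmx_mul trmxK tQ Qw trmx0.
have xw : x^T *m w = w^T *m w.
  have -> : x^T = w^T + x^T *m Q.
    by rewrite [w^T]linearB /= trmx_mul tQ subrK.
  by rewrite mulmxDl -(mulmxA _ Q) Qw mulmx0 addr0.
(* Since the inverse of 0 is 0, [c] also covers [w = 0], where the rank one term vanishes. *)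
pose c := (sqnorm w)^-1.
have c0 : 0 <= c by rewrite invr_ge0 sqnorm_ge0.
have cw : (c * sqnorm w) *: w = w.
  have [->|w0] := eqVneq w 0; first by rewrite scaler0.
  by rewrite mulVf ?scale1r// sqnorm_eq0.
have ww : w^T *m w = (sqnorm w)%:M.
  by rewrite [LHS]mx11_scalar -/(dotp w w) -sqnorm_dotp.
pose u' j := if j == k then Num.sqrt c *: w else u j.
exists u'.
have trZ (a : R) (v : 'cV[R]_m) : (a *: v)^T = a *: v^T by rewrite linearZ.
have uk : u k = 0 by apply: uB; rewrite !inE eqxx.
have QE : \sum_j u' j *m (u' j)^T = Q + c *: (w *m w^T).
  rewrite /Q (bigD1 k)//= [in RHS](bigD1 k)//= uk mul0mx add0r addrC.
  congr (_ + _).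
    by apply: eq_bigr => j /negbTE jk; rewrite /u' jk.
  by rewrite /u' eqxx trZ -scalemxAr -scalemxAl scalerA -expr2 sqr_sqrtr//.
split.
- move=> j; rewrite /u'; case: eqP => // _.
  rewrite sqnorm_dotp /dotp trZ -scalemxAr -scalemxAl scalerA -expr2.
  rewrite sqr_sqrtr// ww !mxE eqxx mulr1n /c.
  by have [->|w0] := eqVneq (sqnorm w) 0; rewrite ?mulr0// mulVf.
- move=> j jA; rewrite /u'; case: eqP => [jk|_]; first by rewrite jk kA in jA.
  by apply: uB; rewrite !inE negb_and jA orbT.
rewrite QE; split.
- by rewrite linearD linearZ /= tQ trmx_mul trmxK.
- rewrite mulmxDl !mulmxDr QQ -!scalemxAl -!scalemxAr.
  rewrite (mulmxA Q) Qw mul0mx scaler0 addr0.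
  rewrite -(mulmxA w _ Q) wQ mulmx0 scaler0 add0r; congr (_ + _).
  rewrite -mulmxA (mulmxA _ w) ww mul_scalar_mx -scalemxAr scalerA.
  by congr (_ *: _); rewrite scalemxAl cw.
have xA : (x^T <= span_mx X A)%MS.
  by have := row_sub k (span_mx X A); rewrite row_span_mx kA.
have QA : (Q <= span_mx X A)%MS.
  rewrite QU; apply/row_subP => i; rewrite row_span_mx !inE.
  case: ifP => [/andP[_ iA]|_]; last exact: sub0mx.
  by have := row_sub i (span_mx X A); rewrite row_span_mx iA.
have wA : (w^T <= span_mx X A)%MS.
  rewrite linearB /= trmx_mul tQ addmx_sub ?eqmx_opp//.
  exact: submx_trans (submxMl _ _) QA.
apply/andP; split.
  by rewrite addmx_sub// scalemx_sub// (submx_trans (submxMl _ _)).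
apply/row_subP => i; rewrite row_span_mx; case: ifP => [iA|_]; last exact: sub0mx.
(* A row fixed by the projection lies in its row space. For [i = k] the two terms rebuild
   [x = Q x + w]; any other column of [A] is fixed by [Q] and orthogonal to [w]. *)
suff H : (col i X)^T *m (Q + c *: (w *m w^T)) = (col i X)^T.
  by rewrite -H submxMl.
rewrite mulmxDr -scalemxAr mulmxA.
have [->|ik] := eqVneq i k.
  rewrite -/x xw ww mul_scalar_mx scalerA -linearZ /= cw linearB /= trmx_mul tQ.
  by rewrite addrC subrK.
have XQ : (col i X)^T *m Q = (col i X)^T.
  have /submxP[M MQ] : ((col i X)^T <= Q)%MS.
    rewrite QU; have := row_sub i (span_mx X (A :\ k)).
    by rewrite row_span_mx !inE ik iA.
  by rewrite MQ -mulmxA QQ.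
by rewrite XQ -{2}XQ -(mulmxA _ Q) Qw mulmx0 mul0mx scaler0 addr0.
Qed.

(** * Projection onto the span of a fixed set of columns, and its complement *)

Section Fixed.
Context {p : nat} (X : 'M[R]_(m, p)) (A : {set 'I_p}).
Let Q := orthproj (span_mx X A).

(** Existence keeps [xget] from falling back on its default value. *)
Lemma orthprojP : is_orthproj (span_mx X A) Q.
Proof.
have [u [_ _ uP]] := orthproj_exists X A.
by rewrite /Q /orthproj; case: xgetP => [P' _ //|/(_ _ uP)].
Qed.

Lemma orthproj_tr : Q^T = Q. Proof. by case: orthprojP. Qed.

Lemma orthproj_idem : Q *m Q = Q. Proof. by case: orthprojP. Qed.

Lemma orthproj_col k : k \in A -> Q *m col k X = col k X.
Proof.
move=> kA; case: orthprojP => tQ QQ /eqmxP QU.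
have /submxP[M MQ] : ((col k X)^T <= Q)%MS.
  by rewrite QU; have := row_sub k (span_mx X A); rewrite row_span_mx kA.
by apply: trmx_inj; rewrite trmx_mul tQ MQ -mulmxA QQ.
Qed.

(** Writes the energy of the projected noise through [#|A|] linear forms with coefficient vectors of
    norm at most 1, so that linear tails and a union bound control it. *)
Lemma sqnorm_orthproj_sum : exists u : 'I_p -> 'cV[R]_m,
  (forall k, sqnorm (u k) <= 1) /\
  (forall v, sqnorm (Q *m v) = \sum_(k in A) dotp (u k) v ^+ 2).
Proof.
have [u [u1 u0 uP]] := orthproj_exists X A; exists u; split => // v.
have QE := is_orthproj_uniq _ _ _ orthprojP uP.
rewrite sqnorm_dotp dotp_mull orthproj_tr mulmxA orthproj_idem QE.
rewrite mulmx_suml /dotp mulmx_sumr summxE.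
rewrite (bigID (mem A))/= [X in _ + X]big1 ?addr0 => [|k kA]; last first.
  by rewrite u0// !mul0mx mulmx0 mxE.
apply: eq_bigr => k _.
by have := dotp_outer (u k) v v; rewrite (dotpC v (u k)) -expr2.
Qed.

Lemma complement_tr : (1%:M - Q)^T = 1%:M - Q.
Proof. by rewrite linearB /= trmx1 orthproj_tr. Qed.

Lemma complement_idem : (1%:M - Q) *m (1%:M - Q) = 1%:M - Q.
Proof.
by rewrite mulmxBl mul1mx mulmxBr mulmx1 orthproj_idem subrr subr0.
Qed.

Lemma complement_dotp u v :
  dotp ((1%:M - Q) *m u) v = dotp ((1%:M - Q) *m u) ((1%:M - Q) *m v).
Proof. by rewrite !dotp_mull complement_tr mulmxA complement_idem. Qed.

Lemma complement_col k : k \in A -> (1%:M - Q) *m col k X = 0.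
Proof. by move=> kA; rewrite mulmxBl mul1mx orthproj_col// subrr. Qed.

(** Pythagoras. *)
Lemma sqnorm_complement v :
  sqnorm ((1%:M - Q) *m v) = sqnorm v - sqnorm (Q *m v).
Proof.
rewrite sqnorm_dotp -complement_dotp mulmxBl mul1mx dotpBl -sqnorm_dotp.
by rewrite [sqnorm (Q *m v)]sqnorm_dotp [in RHS]dotp_mull orthproj_tr mulmxA
  orthproj_idem dotp_mull orthproj_tr.
Qed.
End Fixed.
End OrthogonalProjection.

(** * Deterministic bounds on tilted correlations at a fixed sample size *)

Section TiltedCorrelation.
Context {R : realType} {m p : nat}.
Variables (X : 'M[R]_(m, p)) (beta : 'cV[R]_p) (pi alpha : R).
Hypothesis Xunit : forall j, sqnorm (col j X) = 1.
Hypothesis alpha0 : 0 < alpha.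
Hypothesis Xalpha : forall j, alpha < 1 - a_j X pi j.

Local Notation Q k := (1%:M - Pi X pi k).
Local Notation num k y := (dotp (Xstar X pi k) y).

(** Pythagoras for the unit vector [X_k]; this makes [lambda_k] the coefficient of [beta_k] in the
    inner product of [X_k^*] with the signal. *)
Lemma lambda_sqnorm k : lambda_j X pi k = sqnorm (Xstar X pi k).
Proof. by rewrite sqnorm_complement /lambda_j /a_j Xunit divr1. Qed.

Lemma lambda_gt k : alpha < lambda_j X pi k. Proof. exact: Xalpha. Qed.

Lemma lambda_le1 k : lambda_j X pi k <= 1.
Proof.
by rewrite /lambda_j /a_j Xunit divr1 lerBlDr lerDl sqnorm_ge0.
Qed.

Lemma sqnorm_Xstar_le1 k : sqnorm (Xstar X pi k) <= 1.
Proof. by rewrite -lambda_sqnorm lambda_le1. Qed.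

Lemma dotp_Xstar k y : num k y = num k (Q k *m y).
Proof. exact: complement_dotp. Qed.

Lemma dotp_sum u (F : 'I_p -> 'cV[R]_m) :
  dotp u (\sum_j F j) = \sum_j dotp u (F j).
Proof. by rewrite /dotp mulmx_sumr summxE. Qed.

Lemma dotpZr u c (v : 'cV[R]_m) : dotp u (c *: v) = c * dotp u v.
Proof. by rewrite /dotp -scalemxAr mxE. Qed.

Lemma signalE : X *m beta = \sum_j beta j 0 *: col j X.
Proof.
apply/colP => i; rewrite mxE summxE; apply: eq_bigr => j _.
by rewrite !mxE mulrC.
Qed.

Lemma dotp_signal u : dotp u (X *m beta) = \sum_j beta j 0 * dotp u (col j X).
Proof.
rewrite signalE dotp_sum.
by apply: eq_bigr => j _; rewrite dotpZr.
Qed.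

Lemma signal_complement0 k : supp beta \subset Cset X pi k ->
  Q k *m (X *m beta) = 0.
Proof.
move=> /fintype.subsetP SC; rewrite signalE mulmx_sumr big1// => j _.
have [->|bj] := eqVneq (beta j 0) 0; first by rewrite scale0r mulmx0.
by rewrite -scalemxAr complement_col ?scaler0// SC// inE.
Qed.

(** * Contribution of the signal and size of the rescaling factors *)

Variables (D M tau tau2 : R).
Hypothesis SD : #|supp beta|%:R <= D.
Hypothesis betaM : forall j, j \in supp beta -> `|beta j 0| <= M.
Hypothesis M0 : 0 <= M.
Hypothesis pi0 : 0 <= pi.
Hypothesis tau20 : 0 <= tau2.
Hypothesis Xtau2 : forall j k, k \in supp beta -> k \notin Cset X pi j ->
  k != j -> `|dotp (Pi X pi j *m col j X) (col k X)| <= tau2.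

Lemma betaN0 j : j \notin supp beta -> beta j 0 = 0.
Proof. by rewrite inE negbK => /eqP. Qed.

Lemma num_signal k :
  `|num k (X *m beta) - beta k 0 * lambda_j X pi k| <= D * (M * (pi + tau2)).
Proof.
rewrite dotp_signal (bigD1 k)//= lambda_sqnorm.
rewrite [X in `|X + _ - _|](_ : _ = beta k 0 * sqnorm (Xstar X pi k)); last first.
  by rewrite dotp_Xstar sqnorm_dotp.
rewrite addrAC subrr add0r.
have B0 : 0 <= M * (pi + tau2) by rewrite mulr_ge0// addr_ge0.
apply: (@le_trans _ _ (\sum_(j in supp beta) M * (pi + tau2))); last first.
  by rewrite sumr_const -mulr_natl ler_wpM2r.
apply: le_trans (ler_norm_sum _ _ _) _.
rewrite big_mkcond [leRHS]big_mkcond; apply: ler_sum => j _.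
case: ifPn => [jk|_]; last by case: ifP.
case: ifPn => [jS|/betaN0 ->]; last by rewrite mul0r normr0.
rewrite normrM; apply: ler_pM => //; first exact: betaM.
(* Columns in [C_k] are orthogonal to [X_k^*]. For the others, [X_k^* = X_k - Pi_k X_k]: the first
   part gives at most the threshold [pi], the second at most [tau2]. *)
have [jC|jC] := boolP (j \in Cset X pi k).
  by rewrite dotp_Xstar complement_col// /dotp mulmx0 mxE normr0 addr_ge0.
rewrite /Xstar mulmxBl mul1mx dotpBl.
apply: le_trans (ler_normB _ _) _; apply: lerD; last exact: Xtau2.
have -> : dotp (col k X) (col j X) = corr X k j.
  by rewrite dotpE; apply: eq_bigr => i _; rewrite !mxE.
by move: jC; rewrite inE jk /= -leNgt.
Qed.

(** From the nonnegativity of the squared norms of [u + v] and [u - v]; for unit vectors it is the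
    Cauchy-Schwarz bound. *)
Lemma abs_dotp_le (u v : 'cV[R]_m) : `|dotp u v| <= (sqnorm u + sqnorm v) / 2.
Proof.
have H1 := sqnorm_ge0 (u + v); have H2 := sqnorm_ge0 (u + (-1) *: v).
move: H1 H2; rewrite !sqnormD dotpZr.
have -> : sqnorm ((-1) *: v) = sqnorm v.
  by apply: eq_bigr => i _; rewrite mxE mulN1r sqrrN.
by rewrite ler_norml => H1 H2; apply/andP; split; lra.
Qed.

Lemma sqnorm_signal : sqnorm (X *m beta) <= (D * M) ^+ 2.
Proof.
have D0 : 0 <= D by apply: le_trans SD.
have entry i : `|dotp (X *m beta) (col i X)| <= D * M.
  rewrite dotpC dotp_signal; apply: le_trans (ler_norm_sum _ _ _) _.
  apply: (@le_trans _ _ (\sum_(j in supp beta) M)); last first.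
    by rewrite sumr_const -mulr_natl ler_wpM2r.
  rewrite [leRHS]big_mkcond; apply: ler_sum => j _.
  case: ifPn => [jS|/betaN0 ->]; last by rewrite mul0r normr0.
  rewrite normrM -[leRHS]mulr1; apply: ler_pM => //; first exact: betaM.
  by apply: le_trans (abs_dotp_le _ _) _; rewrite !Xunit; lra.
rewrite sqnorm_dotp dotp_signal; apply: le_trans (ler_norm _) _.
apply: le_trans (ler_norm_sum _ _ _) _.
apply: (@le_trans _ _ (\sum_(j in supp beta) M * (D * M))); last first.
  rewrite sumr_const -mulr_natl expr2 -mulrA ler_wpM2r//.
  by rewrite !mulr_ge0.
rewrite [leRHS]big_mkcond; apply: ler_sum => j _.
case: ifPn => [jS|/betaN0 ->]; last by rewrite mul0r normr0.
by rewrite normrM; apply: ler_pM => //; exact: betaM.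
Qed.

(** Dividing by [Lambda_k], which is at most 1, cannot decrease the modulus. A nonzero numerator
    forces [(I - Pi_k) y] to be nonzero, hence [Lambda_k > 0]. *)
Lemma Lambda_lower k y : `|num k y| <= `|tilted false X pi k y|.
Proof.
rewrite /tilted /= -/(dotp _ _) normrM.
have [->|n0] := eqVneq (num k y) 0; first by rewrite normr0 mulr0.
have Qy0 : sqnorm (Q k *m y) != 0.
  apply: contra n0; rewrite sqnorm_eq0 => /eqP Qy0.
  by rewrite dotp_Xstar Qy0 /dotp mulmx0 mxE.
have y0 : 0 < sqnorm y.
  rewrite lt_neqAle sqnorm_ge0 andbT eq_sym; apply: contra Qy0.
  by rewrite !sqnorm_eq0 => /eqP ->; rewrite mulmx0.
have ayE : 1 - a_jy X pi k y = sqnorm (Q k *m y) / sqnorm y.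
  by rewrite sqnorm_complement /a_jy mulrBl divff// gt_eqF.
have ay1 : 1 - a_jy X pi k y <= 1.
  by rewrite lerBlDr lerDl divr_ge0// sqnorm_ge0.
have ay0 : 0 < 1 - a_jy X pi k y.
  by rewrite ayE divr_gt0// lt_neqAle eq_sym Qy0 sqnorm_ge0.
have ak0 : 0 < 1 - a_j X pi k by apply: lt_trans (Xalpha k).
have L0 : 0 < Lambda_j X pi k y by rewrite sqrtr_gt0 mulr_gt0.
rewrite normfV (gtr0_norm L0) ler_peMl// invf_ge1//.
rewrite -sqrtr1 ler_sqrt//.
apply: mulr_ile1 => //; [exact: ltW|exact: ltW|exact: lambda_le1].
Qed.

(** The hypothesis says that [1 - a_ky] is at least [1 / K] when [y] is nonzero, whence [Lambda_k]
    is at least [sqrt (alpha / K)]. *)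
Lemma Lambda_upper k y K : 0 <= K -> sqnorm y <= K * sqnorm (Q k *m y) ->
  `|tilted false X pi k y| <= `|num k y| * Num.sqrt (K / alpha).
Proof.
move=> K0 yK; rewrite /tilted /= -/(dotp _ _) normrM mulrC.
have [->|n0] := eqVneq (num k y) 0; first by rewrite normr0 !mul0r.
have Qy0 : sqnorm (Q k *m y) != 0.
  apply: contra n0; rewrite sqnorm_eq0 => /eqP Qy0.
  by rewrite dotp_Xstar Qy0 /dotp mulmx0 mxE.
have {}Qy0 : 0 < sqnorm (Q k *m y) by rewrite lt_neqAle eq_sym Qy0 sqnorm_ge0.
have y0 : 0 < sqnorm y.
  rewrite lt_neqAle sqnorm_ge0 andbT eq_sym.
  apply: contraTN Qy0; rewrite sqnorm_eq0 => /eqP ->.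
  by rewrite mulmx0 (eqP (_ : sqnorm 0 == 0)) ?ltxx ?sqnorm_eq0.
have {}K0 : 0 < K.
  rewrite lt_neqAle K0 andbT eq_sym; apply: contraTneq yK => ->.
  by rewrite mul0r -ltNge.
have ayE : 1 - a_jy X pi k y = sqnorm (Q k *m y) / sqnorm y.
  by rewrite sqnorm_complement /a_jy mulrBl divff// gt_eqF.
have ayK : K^-1 <= 1 - a_jy X pi k y.
  by rewrite ayE ler_pdivlMr// mulrC ler_pdivrMr// mulrC.
apply: ler_wpM2l => //.
have L0 : 0 < Num.sqrt (alpha / K) by rewrite sqrtr_gt0 divr_gt0.
have LK : Num.sqrt (alpha / K) <= Lambda_j X pi k y.
  rewrite ler_wsqrtr//; apply: ler_pM => //; rewrite ?invr_ge0 ?ltW//.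
have -> : Num.sqrt (K / alpha) = (Num.sqrt (alpha / K))^-1.
  by rewrite -sqrtrV ?divr_ge0 ?ltW// invf_div.
rewrite ger0_norm ?invr_ge0 ?sqrtr_ge0// lef_pV2// ?posrE//.
exact: lt_le_trans LK.
Qed.

(** * Tilted correlations of the response for a given noise vector *)

Section Noise.
Variable e : 'cV[R]_m.
Let y := X *m beta + e.
Hypothesis tau_ge0 : 0 <= tau.
Hypothesis Xe : forall k, `|num k e| <= tau.
Let B := D * (M * (pi + tau2)) + tau.

Lemma num_response k : `|num k y - beta k 0 * lambda_j X pi k| <= B.
Proof.
rewrite dotpDr addrAC; apply: le_trans (ler_normD _ _) _.
by apply: lerD; [exact: num_signal|exact: Xe].
Qed.

Lemma tilted_lambda k : `|tilted true X pi k y - beta k 0| <= B / alpha.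
Proof.
have l0 : 0 < lambda_j X pi k by apply: lt_trans (lambda_gt k).
have -> : tilted true X pi k y - beta k 0 =
   (num k y - beta k 0 * lambda_j X pi k) / lambda_j X pi k.
  by rewrite /tilted /= -/(dotp _ _); field; rewrite gt_eqF.
rewrite normrM; apply: ler_pM => //; first exact: num_response.
rewrite normfV (gtr0_norm l0) lef_pV2 ?posrE//.
exact/ltW/lambda_gt.
Qed.

Lemma tilted_Lambda_lower k :
  alpha * `|beta k 0| - B <= `|tilted false X pi k y|.
Proof.
apply: le_trans (Lambda_lower _ _).
have := num_response k; rewrite distrC => H.
have := lerB_dist (beta k 0 * lambda_j X pi k) (num k y).
rewrite normrM (ger0_norm (_ : 0 <= lambda_j X pi k)); last first.
  by apply/ltW; apply: lt_trans (lambda_gt k).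
have : alpha * `|beta k 0| <= `|beta k 0| * lambda_j X pi k.
  by rewrite mulrC ler_wpM2l// ltW// lambda_gt.
lra.
Qed.

Variables (s2 nk : R).
Hypothesis s20 : 0 <= s2.
Hypothesis e_le : sqnorm e <= 4 * s2.

(** Here [s2] stands for [sigma^2] and [nk] for [n^kappa]. The two terms of the bound belong to the
    two positions of [S] relative to [C_k]; their sum covers both. *)
Lemma tilted_Lambda_upper k : k \notin supp beta ->
  (1 / 2) * sqnorm (Q k *m (X *m beta)) + s2 / 12 <= sqnorm (Q k *m y) ->
  (~~ (supp beta \subset Cset X pi k) ->
     1 <= nk * (sqnorm (Q k *m (X *m beta)) / sqnorm (X *m beta))) ->
  `|tilted false X pi k y| <= B * Num.sqrt (96 * nk / alpha) +
    tau * Num.sqrt ((24 * (D * M) ^+ 2 / s2 + 96) / alpha).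
Proof.
move=> kS Qy_ge A6.
have D0 : 0 <= D by apply: le_trans SD.
have B0 : 0 <= B by rewrite addr_ge0// !mulr_ge0// addr_ge0.
have y_le : sqnorm y <= 2 * sqnorm (X *m beta) + 8 * s2.
  apply: (le_trans (sqnormD_le _ _)); rewrite lerD2l; have := e_le.
  by set u := sqnorm e; lra.
have numB : `|num k y| <= B.
  by have := num_response k; rewrite betaN0// mul0r subr0.
have [SC|SC] := boolP (supp beta \subset Cset X pi k).
  apply: ler_wpDl; first by rewrite mulr_ge0 ?sqrtr_ge0.
  have nE : num k y = num k e.
    by rewrite dotp_Xstar mulmxDr signal_complement0// add0r -dotp_Xstar.
  (* Without noise the numerator is 0; this case is apart because the constant below divides by
     [s2]. *)
  have [s2E|s2N0] := eqVneq s2 0.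
    have e0 : e = 0.
      apply/eqP; rewrite -sqnorm_eq0 eq_le sqnorm_ge0 andbT.
      by move: e_le; rewrite s2E mulr0.
    rewrite /tilted -/(dotp _ _) nE e0 /dotp mulmx0 mxE mulr0 normr0.
    by rewrite mulr_ge0 ?sqrtr_ge0.
  have s2p : 0 < s2 by rewrite lt_neqAle eq_sym s2N0.
  apply: (@le_trans _ _ (`|num k y| *
      Num.sqrt ((24 * (D * M) ^+ 2 / s2 + 96) / alpha))).
    have K0 : 0 <= 24 * (D * M) ^+ 2 / s2 + 96.
      by rewrite addr_ge0// divr_ge0// mulr_ge0// sqr_ge0.
    apply: Lambda_upper => //.
    (* The factor is [2 (D M)^2 + 8 s2], an upper bound for the squared norm of [y], divided by
       [s2 / 12], the noise part of the lower bound for [(I - Pi_k) y]. *)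
    apply: (@le_trans _ _ ((24 * (D * M) ^+ 2 / s2 + 96) * (s2 / 12))).
      have -> : (24 * (D * M) ^+ 2 / s2 + 96) * (s2 / 12) =
        2 * (D * M) ^+ 2 + 8 * s2 by field.
      by have := sqnorm_signal; lra.
    apply: ler_wpM2l => //; apply: le_trans Qy_ge.
    by rewrite lerDr mulr_ge0// sqnorm_ge0.
  by rewrite ler_wpM2r ?sqrtr_ge0// nE.
have {}A6 := A6 SC.
apply: ler_wpDr; first by rewrite mulr_ge0 ?sqrtr_ge0.
have z0 : 0 < sqnorm (X *m beta).
  rewrite lt_neqAle sqnorm_ge0 andbT eq_sym; apply: contraTneq A6 => ->.
  by rewrite invr0 !mulr0 -ltNge.
have z_le : sqnorm (X *m beta) <= nk * sqnorm (Q k *m (X *m beta)).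
  by move: A6; rewrite mulrA ler_pdivlMr// mul1r.
have Qz_le : sqnorm (Q k *m (X *m beta)) <= sqnorm (X *m beta).
  by rewrite sqnorm_complement lerBlDr lerDl sqnorm_ge0.
(* A projection does not increase the norm, so the ratio in the (A6) bound is at most 1. *)
have nk1 : 1 <= nk.
  rewrite leNgt; apply/negP => nk1.
  have q0 : 0 < sqnorm (Q k *m (X *m beta)).
    rewrite lt_neqAle sqnorm_ge0 andbT eq_sym; apply: contraTneq z_le => ->.
    by rewrite mulr0 -ltNge.
  have : nk * sqnorm (Q k *m (X *m beta)) < sqnorm (Q k *m (X *m beta)).
    by rewrite gtr_pMl.
  by move=> /(le_lt_trans z_le); rewrite ltNge Qz_le.
apply: (@le_trans _ _ (`|num k y| * Num.sqrt (96 * nk / alpha))); last first.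
  by rewrite ler_wpM2r ?sqrtr_ge0.
apply: Lambda_upper; first by rewrite mulr_ge0// (le_trans _ nk1).
apply: le_trans y_le _.
(* The constant 96 is 8 times 12, which matches the noise terms [8 s2] and [s2 / 12]; the signal
   terms then hold with room to spare. *)
apply: (@le_trans _ _ (96 * nk *
   (1 / 2 * sqnorm (Q k *m (X *m beta)) + s2 / 12))); last first.
  by rewrite ler_wpM2l// mulr_ge0// (le_trans _ nk1).
have s2nk : s2 <= nk * s2 by rewrite ler_peMl.
have := sqnorm_ge0 (Q k *m (X *m beta)).
move: z_le; set q := sqnorm (Q k *m _); set z := sqnorm (X *m beta) => z_le q0.
have -> : 96 * nk * (1 / 2 * q + s2 / 12) = 48 * (nk * q) + 8 * (nk * s2).
  by field.
have : 0 <= z by exact: ltW.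
by move: z_le s2nk; set a := nk * q; set b := nk * s2; lra.
Qed.

Lemma complement_response_ge k (N : R) :
  `|dotp (Q k *m (X *m beta)) e| <=
     tau * Num.sqrt (sqnorm (Q k *m (X *m beta))) ->
  sqnorm (Pi X pi k *m e) <= N * tau ^+ 2 -> s2 / 3 <= sqnorm e ->
  N * tau ^+ 2 + 2 * tau ^+ 2 <= s2 / 4 ->
  (1 / 2) * sqnorm (Q k *m (X *m beta)) + s2 / 12 <= sqnorm (Q k *m y).
Proof.
move=> ze Pe e_ge Ntau.
rewrite /y mulmxDr sqnormD -complement_dotp (sqnorm_complement X _ e).
move: ze; rewrite ler_norml => /andP[ze _].
have := sqr_sqrtr (sqnorm_ge0 (Q k *m (X *m beta))).
set a := Num.sqrt _ in ze *; move=> aE.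
(* Absorbs the cross term: [2 tau a <= a^2 / 2 + 2 tau^2]. What is left of the noise energy is at
   least [s2 / 3 - s2 / 4 = s2 / 12]. *)
have := sqr_ge0 (a - 2 * tau); rewrite sqrrB -aE.
move: Pe; rewrite /Pi; set b := sqnorm (_ *m e); set c := sqnorm e in e_ge *.
set x := dotp _ e in ze *; lra.
Qed.
End Noise.
End TiltedCorrelation.

(** * The good event and its probability *)

Section GoodEvent.
Context {R : realType} {d : measure_display} {T : measurableType d}.
Variable P : probability T R.

Lemma measure_bigsetU_le {I : Type} (r : seq I) (A : I -> set T) (c : R) :
  (forall i, measurable (A i)) -> (forall i, (P (A i) <= c%:E)%E) ->
  (P (\big[setU/set0]_(i <- r) A i) <= ((size r)%:R * c)%:E)%E.
Proof.
move=> mA Ac; elim: r => [|i r IH]; first by rewrite big_nil measure0 mul0r.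
rewrite big_cons /= -natr1 mulrDl mul1r addrC EFinD.
apply: le_trans (measureU2 _ _ _) _ => //.
  by apply: bigsetU_measurable.
by apply: leeD; [exact: Ac|exact: IH].
Qed.

Context {m : nat} (e : 'I_m -> T -> R).
Local Notation noise t := (\col_i e i t).

Lemma dotp_noise (v : 'cV[R]_m) t :
  dotp v (noise t) = \sum_i v i 0 * e i t.
Proof. by rewrite dotpE; apply: eq_bigr => i _; rewrite mxE. Qed.

Lemma sqnorm_noise t : sqnorm (noise t) = \sum_i (e i t) ^+ 2.
Proof. by apply: eq_bigr => i _; rewrite mxE. Qed.

Lemma gaussian_good_event (s tau : R) {I : finType} (V : I -> 'cV[R]_m) :
  0 < s -> 0 < tau -> iid_gaussian P e s ->
  exists G, [/\ measurable G,
    (P (~` G) <= (#|I|%:R * (2 * expR (- (tau ^+ 2 / (2 * s ^+ 2)))) +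
       (2 * expR (- (3 / 2))) ^+ m + (expR (1 / 2) / 2) ^+ m)%:E)%E &
    forall t, G t ->
      (forall i, `|dotp (V i) (noise t)| <= tau * Num.sqrt (sqnorm (V i))) /\
      m%:R * s ^+ 2 / 3 <= sqnorm (noise t) <= 4 * m%:R * s ^+ 2].
Proof.
move=> s0 tau0 He.
have me := iid_gaussian_measurable P e s s0 He.
have mS : measurable_fun setT (fun t => \sum_i (e i t) ^+ 2).
  by apply: measurable_sum => i; apply: measurable_funX.
pose A i := [set t | tau * Num.sqrt (\sum_j V i j 0 ^+ 2) <
  `|\sum_j V i j 0 * e j t| ].
have mA i : measurable (A i).
  apply: measurable_strict_superlevel; apply: measurableT_comp => //.
  exact: (measurable_linear P e s s0 He).
pose U := [set t | 4 * m%:R * s ^+ 2 <= \sum_i (e i t) ^+ 2].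
pose L := [set t | \sum_i (e i t) ^+ 2 <= m%:R * s ^+ 2 / 3].
have mU : measurable U by exact: measurable_superlevel.
have mL : measurable L by exact: measurable_sublevel.
pose W := \big[setU/set0]_(i <- enum I) A i.
have mW : measurable W by apply: bigsetU_measurable.
have mWUL : measurable (W `|` U `|` L).
  by apply: measurableU => //; exact: measurableU.
exists (~` (W `|` U `|` L)); split.
- exact: measurableC.
- rewrite setCK !EFinD; apply: le_trans (measureU2 _ _ _) _ => //.
    exact: measurableU.
  apply: leeD; last exact: (gaussian_sqnorm_lower P e s s0 He).
  apply: le_trans (measureU2 _ _ _) _ => //.
  apply: leeD; last exact: (gaussian_sqnorm_upper P e s s0 He).
  rewrite cardE; apply: measure_bigsetU_le => // i.
  exact: (gaussian_linear_tail P e s s0 He).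
- move=> t /= /not_orP[/not_orP[tW /negP tU] /negP tL].
  split; last first.
    by rewrite sqnorm_noise; move: tU tL; rewrite -!ltNge => /ltW -> /ltW ->.
  move=> i; rewrite dotp_noise leNgt; apply/negP => ti; apply: tW.
  by rewrite /W -bigcup_seq; exists i => //=; rewrite mem_enum.
Qed.

(** Collects the stochastic input in one event. The bound on [N] is asked only for [sigma > 0],
    since it would fail for [sigma = 0] and [N >= 0]. *)
Lemma model_good_event {p : nat} (X : 'M[R]_(m, p)) (beta : 'cV[R]_p)
    (pi sigma tau : R) :
  (forall j, sqnorm (col j X) = 1) -> (0 < m)%N -> 0 <= sigma -> 0 < tau ->
  iid_gaussian P e (sigma / Num.sqrt m%:R) ->
  exists G, [/\ measurable G,
    (P (~` G) <= (if sigma == 0 then 0 else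
       6 * p%:R ^+ 2 * expR (- (tau ^+ 2 * m%:R / (2 * sigma ^+ 2))) +
       (2 * expR (- (3 / 2))) ^+ m + (expR (1 / 2) / 2) ^+ m)%:E)%E &
    forall t, G t -> [/\
      forall k, `|dotp (Xstar X pi k) (noise t)| <= tau,
      sqnorm (noise t) <= 4 * sigma ^+ 2 &
      forall k N, #|Cset X pi k|%:R <= N ->
        (0 < sigma -> N * tau ^+ 2 + 2 * tau ^+ 2 <= sigma ^+ 2 / 4) ->
        1 / 2 * sqnorm ((1%:M - Pi X pi k) *m (X *m beta)) + sigma ^+ 2 / 12
          <= sqnorm ((1%:M - Pi X pi k) *m response X beta e t)]].
Proof.
move=> Xunit m0 sigma0 tau0 He.
have m0R : 0 < m%:R :> R by rewrite ltr0n.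
have [s0|sN0] := eqVneq sigma 0.
  have e0 t : noise t = 0.
    move: He; rewrite s0 mul0r /iid_gaussian eqxx => e0.
    by apply/colP => i; rewrite !mxE e0.
  exists setT; split => //.
    by rewrite setCT measure0.
  move=> t _; rewrite /response e0 s0 expr0n/=; split => [k||k N _ _].
  - by rewrite /dotp mulmx0 mxE normr0 ltW.
  - by rewrite mulr0 (eqP (_ : sqnorm 0 == 0)) ?sqnorm_eq0.
  - rewrite mul0r !addr0.
    by have := sqnorm_ge0 ((1%:M - Pi X pi k) *m (X *m beta)); lra.
have sp : 0 < sigma by rewrite lt_neqAle eq_sym sN0.
have /choice[u Hu] : forall k, exists u : 'I_p -> 'cV[R]_m,
    (forall l, sqnorm (u l) <= 1) /\
    (forall v, sqnorm (Pi X pi k *m v) =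
       \sum_(l in Cset X pi k) dotp (u l) v ^+ 2).
  by move=> k; exact: sqnorm_orthproj_sum.
(* These vectors control, in turn, the numerators, the cross terms of signal and noise, and the
   projected noise. *)
pose V (i : 'I_p + 'I_p + 'I_p * 'I_p) := match i with
  | inl (inl k) => Xstar X pi k
  | inl (inr k) => (1%:M - Pi X pi k) *m (X *m beta)
  | inr (k, l) => u k l
  end.
have ss0 : 0 < sigma / Num.sqrt m%:R by rewrite divr_gt0// sqrtr_gt0.
have ssE : (sigma / Num.sqrt m%:R) ^+ 2 = sigma ^+ 2 / m%:R.
  by rewrite expr_div_n sqr_sqrtr// ltW.
have [G [mG PG HG]] := gaussian_good_event _ tau V ss0 tau0 He.
exists G; split => //.
  apply: le_trans PG _; rewrite lee_fin !lerD2r ssE.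
  have -> : tau ^+ 2 / (2 * (sigma ^+ 2 / m%:R)) =
    tau ^+ 2 * m%:R / (2 * sigma ^+ 2) by field; rewrite sN0 gt_eqF.
  rewrite mulrA ler_wpM2r ?expR_ge0// !card_sum card_prod card_ord.
  (* Two tails for each of at most [3 p^2] vectors give the factor [6 p^2]. *)
  have : (p + p + p * p <= 3 * (p * p))%N.
    have pp : (p <= p * p)%N by case: (p) => // q; exact: leq_pmulr.
    by rewrite !mulSn mul0n addn0 addnA !leq_add.
  rewrite -(ler_nat R) natrM natrM expr2.
  by set a := (p + p + _)%:R; lra.
move=> t /HG[tV /andP[tL tU]].
have small (v : 'cV[R]_m) c : sqnorm v <= 1 ->
    `|c| <= tau * Num.sqrt (sqnorm v) -> `|c| <= tau.
  move=> v1 /le_trans; apply; rewrite -[leRHS]mulr1 ler_wpM2l ?(ltW tau0)//.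
  by rewrite -sqrtr1 ler_wsqrtr.
split.
- move=> k; apply: small (tV (inl (inl k))).
  exact: sqnorm_Xstar_le1.
- apply: le_trans tU _; rewrite ssE.
  by rewrite le_eqVlt; apply/orP; left; apply/eqP; field; rewrite gt_eqF.
- move=> k N CN /(_ sp) Ntau.
  apply: (complement_response_ge X beta pi tau (noise t) (sigma ^+ 2) k N) => //.
  + exact: (tV (inl (inr k))).
  + have [u1 ->] := Hu k.
    apply: (@le_trans _ _ (\sum_(l in Cset X pi k) tau ^+ 2)).
      apply: ler_sum => l _; rewrite -real_normK ?num_real//.
      rewrite ler_sqr ?nnegrE ?(ltW tau0)//.
      exact: small (u1 l) (tV (inr (k, l))).
    by rewrite sumr_const -mulr_natl ler_wpM2r// sqr_ge0.
  + apply: le_trans tL; rewrite ssE.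
    by rewrite le_eqVlt; apply/orP; left; apply/eqP; field; rewrite gt_eqF.
Qed.
End GoodEvent.

(** * Powers of the sample size and rates of convergence *)

Section PowerAsymptotics.
Context {R : realType}.

Lemma powR_natD (n : nat) (a b : R) : (0 < n)%N ->
  n%:R `^ (a + b) = n%:R `^ a * n%:R `^ b.
Proof. by move=> n0; rewrite powRD// pnatr_eq0 -lt0n n0 implybT. Qed.

Lemma cvg_powR_nat (a : R) : a < 0 -> n%:R `^ a @[n --> \oo] --> (0 : R).
Proof.
move=> a0; apply/cvgr0Pnorm_lt => eps eps0; near=> n.
have n0 : 0 < n%:R :> R by near: n; exact: nbhs_infty_gtr.
rewrite ger0_norm ?powR_ge0// -[a]opprK powRN.
rewrite -[eps]invrK ltf_pV2 ?posrE ?powR_gt0 ?invr_gt0//.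
have Na0 : - a != 0 by rewrite oppr_eq0 lt_eqF.
have -> : eps^-1 = (eps^-1 `^ (- a)^-1) `^ (- a).
  by rewrite -powRrM mulVf// powRr1// invr_ge0 ltW.
apply: gt0_ltr_powR; rewrite ?oppr_gt0 ?nnegrE ?powR_ge0//.
by near: n; exact: nbhs_infty_gtr.
Unshelve. all: by end_near. Qed.

Lemma cvg_mull_powR_nat (c a : R) : a < 0 ->
  c * n%:R `^ a @[n --> \oo] --> (0 : R).
Proof.
by move=> a0; rewrite -(mulr0 c); apply: cvgM; [exact: cvg_cst|exact: cvg_powR_nat].
Qed.

(** [p^2] grows at most like [exp (2 K n^theta)], which [exp (- c n^a)] with
    [a = 1 - 2 gamma > theta] outweighs. The other two terms are geometric with ratio below 1. *)
Lemma cvg_failure_probability (p : nat -> nat) (sigma gamma theta : R) (K N : nat) :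
  0 < sigma -> 0 < 1 - 2 * gamma -> theta < 1 - 2 * gamma ->
  (forall n, (N <= n)%N -> ln ((p n)%:R : R) <= K%:R * (n%:R `^ theta)) ->
  6 * (p n)%:R ^+ 2 *
     expR (- ((n%:R `^ (- gamma)) ^+ 2 * n%:R / (2 * sigma ^+ 2))) +
   (2 * expR (- (3 / 2))) ^+ n + (expR (1 / 2) / 2) ^+ n @[n --> \oo] --> (0 : R).
Proof.
move=> s0 a0 ta pK; set a := 1 - 2 * gamma in a0 ta.
rewrite -[0 : R]addr0; apply: cvgD; last first.
  apply: cvg_expr; rewrite ger0_norm ?divr_ge0 ?expR_ge0//.
  rewrite ltr_pdivrMr// !mul1r -[2^-1]opprK expRN invf_plt ?posrE ?expR_gt0//.
  (* [1 + x < exp x] at [x = - 1/2] gives [exp (1/2) < 2]. *)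
  have := @expR_gt1Dx R (- 2^-1).
  have -> : (1 - 2^-1 : R) = 2^-1 by field.
  by apply; rewrite oppr_eq0 invr_eq0.
rewrite -[0 : R]addr0; apply: cvgD; last first.
  apply: cvg_expr; rewrite ger0_norm ?mulr_ge0 ?expR_ge0//.
  rewrite expRN -ltr_pdivlMl// mulr1 ltf_pV2 ?posrE ?expR_gt0//.
  by apply: lt_le_trans (expR_ge1Dx _); lra.
pose c : R := (2 * sigma ^+ 2)^-1.
have c0 : 0 < c by rewrite invr_gt0 mulr_gt0// exprn_gt0.
(* Half of the exponent [c n^a] absorbs [p^2]; the other half is bounded through
   [exp (- x) <= 1 / x]. *)
apply: (@squeeze_cvgr _ _ _ _ (cst 0) (fun n => 12 / c * n%:R `^ (- a))); last 2 first.
- exact: cvg_cst.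
- by apply: cvg_mull_powR_nat; rewrite oppr_lt0.
have small : \forall n \near \oo, 2 * K%:R * n%:R `^ (theta - a) < c / 2.
  have /cvgr0Pnorm_lt/(_ (c / 2)) : 2 * K%:R * n%:R `^ (theta - a) @[n --> \oo] --> (0 : R).
    by apply: cvg_mull_powR_nat; rewrite subr_lt0.
  move=> /(_ _)[|n0 _ Hn]; first by rewrite divr_gt0.
  by exists n0 => // n /Hn; apply: le_lt_trans; exact: ler_norm.
near=> n.
have n0 : (0 < n)%N by near: n; exact: nbhs_infty_gt.
have n0R : 0 < n%:R :> R by rewrite ltr0n.
apply/andP; split; first by rewrite mulr_ge0 ?expR_ge0// mulr_ge0// sqr_ge0.
pose na : R := n%:R `^ a.
have na0 : 0 < na by rewrite powR_gt0.
have -> : (n%:R `^ (- gamma)) ^+ 2 * n%:R / (2 * sigma ^+ 2) = c * na.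
  rewrite mulrC -/c; congr (_ * _).
  rewrite -{2}(powRr1 (ltW n0R)) expr2 -!powR_natD// /na /a; congr (_ `^ _); ring.
have small_n : 2 * K%:R * n%:R `^ theta < c / 2 * na.
  have -> : theta = (theta - a) + a by rewrite subrK.
  by rewrite powR_natD// mulrA ltr_pM2r//; near: n.
have pn : (p n)%:R <= expR (K%:R * n%:R `^ theta) :> R.
  (* The bound on [ln] carries information only for positive [p n]. *)
  have [->|p0] := eqVneq (p n) 0%N; first exact: expR_ge0.
  rewrite -[leLHS]lnK ?ler_expR; last by rewrite posrE ltr0n lt0n.
  by apply: pK; near: n; exact: nbhs_infty_ge.
have -> : 12 / c * n%:R `^ (- a) = 6 * (c / 2 * na)^-1.
  by rewrite powRN -/na; field; rewrite !gt_eqF.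
rewrite -mulrA ler_pM2l//.
apply: (@le_trans _ _ (expR (- (c / 2 * na)))).
  apply: (@le_trans _ _ (expR (2 * K%:R * n%:R `^ theta) * expR (- (c * na)))).
    rewrite ler_wpM2r ?expR_ge0//.
    have -> : 2 * K%:R * n%:R `^ theta = K%:R * n%:R `^ theta + K%:R * n%:R `^ theta by ring.
    by rewrite expRD expr2; apply: ler_pM.
  by rewrite -expRD ler_expR; lra.
rewrite expRN lef_pV2 ?posrE ?expR_gt0 ?mulr_gt0 ?divr_gt0//.
by apply: le_trans (expR_ge1Dx _); rewrite lerDr.
Unshelve. all: by end_near. Qed.

(* [B / alpha] bounds the error for the factor [lambda_k]; the other two terms
   are those for [Lambda_k], according to whether [S] is contained in [C_k]. *)
Lemma error_rate (n : nat)
    (mu kappa delta gamma alpha K M C1 C2 s2 A g B : R) :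
  (0 < n)%N -> 0 <= delta -> 0 < alpha -> 0 <= K -> 0 <= M -> 0 <= C1 ->
  0 <= C2 -> 0 <= s2 ->
  A = K * M * (C1 + C2) + 1 -> g = n%:R `^ (- gamma) ->
  B = K * n%:R `^ delta * (M * (C1 * g + C2 * g)) + g ->
  n%:R `^ mu * (B / alpha + B * Num.sqrt (96 * n%:R `^ kappa / alpha) +
    g * Num.sqrt ((24 * (K * n%:R `^ delta * M) ^+ 2 / s2 + 96) / alpha)) <=
  (A / alpha + Num.sqrt ((24 * (K * M) ^+ 2 / s2 + 96) / alpha)) *
      n%:R `^ (mu + delta - gamma) +
  A * Num.sqrt (96 / alpha) * n%:R `^ (mu + kappa / 2 + delta - gamma).
Proof.
move=> n0 d0 al0 K0 M0 C10 C20 s20 AE gE BE.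
rewrite !powR_natD// -gE.
have -> : n%:R `^ kappa = (n%:R `^ (kappa / 2)) ^+ 2.
  by rewrite expr2 -powR_natD// -splitr.
set nm := n%:R `^ mu; set hk := n%:R `^ (kappa / 2).
(* Lets the lone [g] in [B] and the constant 96 under the root be absorbed into terms carrying
   [n^delta]. *)
have dl1 : 1 <= n%:R `^ delta.
  have n1 : 1 <= n%:R :> R by rewrite ler1n.
  by have := ler_powR n1 d0; rewrite powRr0.
rewrite BE; set dl := n%:R `^ delta in dl1 *.
have nm0 : 0 <= nm by exact: powR_ge0.
have hk0 : 0 <= hk by exact: powR_ge0.
have g0 : 0 <= g by rewrite gE; exact: powR_ge0.
have B_le : K * dl * (M * (C1 * g + C2 * g)) + g <= A * (dl * g).
  rewrite AE; have -> : (K * M * (C1 + C2) + 1) * (dl * g) =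
    K * dl * (M * (C1 * g + C2 * g)) + dl * g by ring.
  by rewrite lerD2l ler_peMl.
have -> : Num.sqrt (96 * hk ^+ 2 / alpha) = hk * Num.sqrt (96 / alpha).
  have -> : 96 * hk ^+ 2 / alpha = hk ^+ 2 * (96 / alpha) by ring.
  by rewrite sqrtrM ?sqr_ge0// sqrtr_sqr ger0_norm.
set S := Num.sqrt (96 / alpha).
have S0 : 0 <= S by exact: sqrtr_ge0.
have S2 : Num.sqrt ((24 * (K * dl * M) ^+ 2 / s2 + 96) / alpha) <=
  dl * Num.sqrt ((24 * (K * M) ^+ 2 / s2 + 96) / alpha).
  have dl0 : 0 <= dl by exact: powR_ge0.
  rewrite -[X in _ <= X * _](ger0_norm dl0).
  rewrite -sqrtr_sqr -sqrtrM ?sqr_ge0// ler_wsqrtr// [leRHS]mulrA.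
  rewrite ler_wpM2r ?invr_ge0 ?(ltW al0)// mulrDr.
  have -> : dl ^+ 2 * (24 * (K * M) ^+ 2 / s2) = 24 * (K * dl * M) ^+ 2 / s2 by ring.
  by rewrite lerD2l ler_peMl// exprn_ege1.
set S1 := Num.sqrt _ in S2 *; set S3 := Num.sqrt (_ / alpha) in S2 *.
have -> : (A / alpha + S3) * (nm * dl * g) + A * S * (nm * hk * dl * g) =
  nm * (A * (dl * g) / alpha + A * (dl * g) * (hk * S) + g * (dl * S3)) by ring.
rewrite ler_wpM2l//; apply: lerD; first apply: lerD.
- by rewrite ler_wpM2r ?invr_ge0 ?(ltW al0).
- by rewrite ler_wpM2r ?mulr_ge0.
- by rewrite ler_wpM2l.
Qed.
End PowerAsymptotics.

(** * Assembly: uniform rates on the good event *)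

Theorem theorem1
  (R : realType) (d : measure_display) (T : measurableType d)
  (P : probability T R)
  (p : nat -> nat)
  (X : forall n : nat, 'M[R]_(n, p n))
  (beta : forall n : nat, 'cV[R]_(p n))
  (sigma : R)
  (eps : forall n : nat, 'I_n -> T -> R)
  (delta gamma theta xi mu kappa C1 alpha : R)
  (* model *)
  (Hcol : forall n, (0 < n)%N -> forall j : 'I_(p n), sqnorm (col j (X n)) = 1)
  (Hsigma : 0 <= sigma)
  (Heps : forall n, (0 < n)%N ->
            iid_gaussian P (eps n) (sigma / Num.sqrt (n%:R)))
  (* (A1) *)
  (Hdelta : 0 <= delta < 2^-1)
  (HA1 : exists K N : nat, forall n, (N <= n)%N ->
           #|supp (beta n)|%:R <= K%:R * (n%:R `^ delta))
  (* (A2) *)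
  (Hgamma : delta < gamma < 2^-1)
  (Htheta : 0 <= theta < 1 - 2 * gamma)
  (HA2 : exists K N : nat, forall n, (N <= n)%N ->
           ln ((p n)%:R) <= K%:R * (n%:R `^ theta))
  (* (A3), with pi_n = C1 n^{-gamma} *)
  (HC1 : 0 < C1)
  (Hxi : 0 <= xi < 2 * (gamma - delta))
  (HA3 : exists C : R, 0 < C /\ forall n, (0 < n)%N -> forall j : 'I_(p n),
           #|Cset (X n) (C1 * n%:R `^ (- gamma)) j|%:R <= C * (n%:R `^ xi))
  (* (A4) *)
  (Hmu : 0 <= mu < gamma - delta - xi / 2)
  (HA4a : exists M : R, 0 < M /\ forall n, (0 < n)%N ->
           forall j, j \in supp (beta n) -> `|beta n j 0| < M)
  (HA4b : exists b : nat -> R, b @ \oo --> +oo /\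
           forall n, (0 < n)%N -> forall j, j \in supp (beta n) ->
             b n <= n%:R `^ mu * `|beta n j 0|)
  (* (A5) *)
  (Halpha : 0 < alpha < 1)
  (HA5 : forall n, (0 < n)%N -> forall j : 'I_(p n),
           alpha < 1 - a_j (X n) (C1 * n%:R `^ (- gamma)) j)
  (* (A6) *)
  (Hkappa : 0 <= kappa / 2 + mu < gamma - delta - xi / 2)
  (HA6 : exists b : nat -> R, b @ \oo --> +oo /\
           forall n, (0 < n)%N -> forall j : 'I_(p n),
             ~~ (supp (beta n) \subset Cset (X n) (C1 * n%:R `^ (- gamma)) j) ->
             b n <= n%:R `^ kappa *
               (sqnorm ((1%:M - Pi (X n) (C1 * n%:R `^ (- gamma)) j)
                          *m (X n *m beta n))
                / sqnorm (X n *m beta n)))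
  (* additional condition *)
  (Hextra : exists C : R, 0 < C /\ forall n, (0 < n)%N -> forall j k : 'I_(p n),
           k \in supp (beta n) ->
           k \notin Cset (X n) (C1 * n%:R `^ (- gamma)) j -> k != j ->
           `|((Pi (X n) (C1 * n%:R `^ (- gamma)) j *m col j (X n))^T
               *m col k (X n)) 0 0| <= C * n%:R `^ (- gamma)) :
  (* b = true : rescaling lambda_j ; b = false : rescaling Lambda_j *)
  forall b : bool,
  exists E : nat -> set T,
    (forall n, measurable (E n)) /\
    (P (E n) @[n --> \oo] --> 1%E) /\
    (* E_1 : max_{k notin S} |c_k^*| / min_{j in S} |c_j^*| -> 0 *)
    (exists r : nat -> R, r @ \oo --> 0 /\
       forall n, (0 < n)%N -> forall t, E n t ->
       forall j k : 'I_(p n), j \in supp (beta n) -> k \notin supp (beta n) ->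
         `|tilted b (X n) (C1 * n%:R `^ (- gamma)) k
              (response (X n) (beta n) (eps n) t)|
         <= r n * `|tilted b (X n) (C1 * n%:R `^ (- gamma)) j
              (response (X n) (beta n) (eps n) t)|) /\
    (* (i) *)
    (exists r : nat -> R, r @ \oo --> 0 /\
       forall n, (0 < n)%N -> forall t, E n t ->
       forall k : 'I_(p n), k \notin supp (beta n) ->
         n%:R `^ mu * `|tilted b (X n) (C1 * n%:R `^ (- gamma)) k
              (response (X n) (beta n) (eps n) t)| <= r n) /\
    (* (ii) *)
    (exists r : nat -> R, r @ \oo --> +oo /\
       forall n, (0 < n)%N -> forall t, E n t ->
       forall j : 'I_(p n), j \in supp (beta n) ->
         r n <= n%:R `^ mu * `|tilted b (X n) (C1 * n%:R `^ (- gamma)) j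
              (response (X n) (beta n) (eps n) t)|) /\
    (* (iii) *)
    (b = true ->
     exists r : nat -> R, r @ \oo --> 0 /\
       forall n, (0 < n)%N -> forall t, E n t ->
       forall j : 'I_(p n), j \in supp (beta n) ->
         `|tilted b (X n) (C1 * n%:R `^ (- gamma)) j
              (response (X n) (beta n) (eps n) t) / beta n j 0 - 1| <= r n).
Proof.
move=> b.
move: HA1 HA2 HA3 HA4a HA4b HA6 Hextra => [K [N1 A1]] [K2 [N2 A2]] [Cc [Cc0 A3]]
  [M [M0 A4a]] [b4 [b4y A4b]] [b6 [b6y A6]] [C2 [C20 Aextra]].
move: Hdelta Hgamma Htheta Hxi Hmu Halpha Hkappa => /andP[d0 d1] /andP[dg g1]
  /andP[th0 th1] /andP[xi0 xi1] /andP[mu0 mu1] /andP[al0 al1] /andP[ka0 ka1].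
pose tau n : R := n%:R `^ (- gamma).
have tau_gt0 n : (0 < n)%N -> 0 < tau n by move=> n0; rewrite powR_gt0// ltr0n.
pose q n : R := if sigma == 0 then 0 else
  6 * (p n)%:R ^+ 2 * expR (- (tau n ^+ 2 * n%:R / (2 * sigma ^+ 2))) +
  (2 * expR (- (3 / 2))) ^+ n + (expR (1 / 2) / 2) ^+ n.
have q0 : q n @[n --> \oo] --> (0 : R).
  rewrite /q; have [s0|sN0] := eqVneq sigma 0; first exact: cvg_cst.
  apply: (cvg_failure_probability p sigma gamma theta K2 N2 _ _ th1 A2).
    by rewrite lt_neqAle eq_sym sN0.
  lra.
have /choice[G HG] : forall n, exists G, [/\ measurable G,
    (0 < n)%N -> (P (~` G) <= (q n)%:E)%E &
    (0 < n)%N -> forall t, G t -> [/\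
      forall k, `|dotp (Xstar (X n) (C1 * tau n) k) (\col_i eps n i t)| <= tau n,
      sqnorm (\col_i eps n i t) <= 4 * sigma ^+ 2 &
      forall k N, #|Cset (X n) (C1 * tau n) k|%:R <= N ->
        (0 < sigma -> N * tau n ^+ 2 + 2 * tau n ^+ 2 <= sigma ^+ 2 / 4) ->
        1 / 2 * sqnorm ((1%:M - Pi (X n) (C1 * tau n) k) *m (X n *m beta n))
          + sigma ^+ 2 / 12 <=
        sqnorm ((1%:M - Pi (X n) (C1 * tau n) k) *m
          response (X n) (beta n) (eps n) t)]].
  move=> n; have [->|n0] := posnP n; first by exists setT.
  have [G [mG PG HG]] := model_good_event P (eps n) (X n) (beta n) (C1 * tau n)
    sigma (tau n) (Hcol n n0) n0 Hsigma (tau_gt0 n n0) (Heps n n0).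
  by exists G.
pose A : R := K%:R * M * (C1 + C2) + 1.
pose B n : R := K%:R * n%:R `^ delta * (M * (C1 * tau n + C2 * tau n)) + tau n.
(* One error bound for both rescaling factors; [r1] dominates [n^mu U]. *)
pose U n : R := B n / alpha + B n * Num.sqrt (96 * n%:R `^ kappa / alpha) +
  tau n * Num.sqrt
    ((24 * (K%:R * n%:R `^ delta * M) ^+ 2 / sigma ^+ 2 + 96) / alpha).
pose r1 n : R :=
  (A / alpha + Num.sqrt ((24 * (K%:R * M) ^+ 2 / sigma ^+ 2 + 96) / alpha)) *
      n%:R `^ (mu + delta - gamma) +
  A * Num.sqrt (96 / alpha) * n%:R `^ (mu + kappa / 2 + delta - gamma).
(* Both exponents are negative by the bounds on [mu] and [kappa / 2 + mu], as [xi >= 0]. *)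
have r10 : r1 n @[n --> \oo] --> (0 : R).
  by rewrite -[0 : R]addr0; apply: cvgD; apply: cvg_mull_powR_nat; lra.
have U_le n : (0 < n)%N -> n%:R `^ mu * U n <= r1 n.
  move=> n0; apply: (error_rate n mu kappa delta gamma alpha K%:R M C1 C2) => //.
  - exact: ltW.
  - exact: ltW.
  - exact: ltW.
  - exact: sqr_ge0.
have U_ge n : [/\ 0 <= B n, B n / alpha <= U n, 0 <= U n &
    B n * Num.sqrt (96 * n%:R `^ kappa / alpha) + tau n * Num.sqrt
     ((24 * (K%:R * n%:R `^ delta * M) ^+ 2 / sigma ^+ 2 + 96) / alpha) <= U n].
  have t0 : 0 <= tau n by exact: powR_ge0.
  have B0 : 0 <= B n.
    rewrite addr_ge0// mulr_ge0 ?mulr_ge0 ?powR_ge0// ?(ltW M0)//.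
    by rewrite addr_ge0// mulr_ge0// ltW.
  have Ba : 0 <= B n / alpha by rewrite divr_ge0// ltW.
  have u2 : 0 <= B n * Num.sqrt (96 * n%:R `^ kappa / alpha).
    by rewrite mulr_ge0// sqrtr_ge0.
  have u3 : 0 <= tau n * Num.sqrt
     ((24 * (K%:R * n%:R `^ delta * M) ^+ 2 / sigma ^+ 2 + 96) / alpha).
    by rewrite mulr_ge0// sqrtr_ge0.
  by split => //; rewrite /U ?addr_ge0//; lra.
(* Comes from multiplying [alpha |beta_j| - U] by [n^mu], with [b4] the rate of (A4). *)
pose r2 n : R := alpha * b4 n - r1 n.
have r2y : r2 @ \oo --> +oo.
  apply/cvgryPge => L; near=> n.
  have r1n : `|r1 n| < 1.
    by near: n; move/cvgr0Pnorm_lt : r10; apply.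
  have b4n : (L + 1) / alpha <= b4 n.
    by near: n; move/cvgryPge : b4y; apply.
  move: b4n; rewrite ler_pdivrMr// mulrC => b4n.
  by move: r1n; rewrite ltr_norml => /andP[_]; rewrite /r2; lra.
(* [1 <= b6 n] turns (A6) into a bound with constant 1. The last condition holds eventually because
   [xi < 2 gamma]: projected noise of energy [n^(xi - 2 gamma)] is negligible against [sigma^2]. *)
pose ok n := [/\ (0 < n)%N, (N1 <= n)%N, 1 <= b6 n, 0 < b4 n & 0 < r2 n /\
  (0 < sigma -> Cc * n%:R `^ xi * tau n ^+ 2 + 2 * tau n ^+ 2 <= sigma ^+ 2 / 4)].
have ok_near : \forall n \near \oo, ok n.
  have small : 0 < sigma -> \forall n \near \oo,
      Cc * n%:R `^ xi * tau n ^+ 2 + 2 * tau n ^+ 2 <= sigma ^+ 2 / 4.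
    move=> s0.
    have lim : Cc * n%:R `^ (xi - 2 * gamma) + 2 * n%:R `^ (- 2 * gamma)
        @[n --> \oo] --> (0 : R).
      by rewrite -[0 : R]addr0; apply: cvgD; apply: cvg_mull_powR_nat; lra.
    have e0 : 0 < sigma ^+ 2 / 4 by rewrite divr_gt0// exprn_gt0.
    near=> n.
    have n0 : (0 < n)%N by near: n; exact: nbhs_infty_gt.
    have -> : tau n ^+ 2 = n%:R `^ (- 2 * gamma).
      by rewrite expr2 -powR_natD//; congr (_ `^ _); ring.
    rewrite -mulrA -powR_natD// mulNr; apply: le_trans (ler_norm _) _.
    apply: ltW; near: n; move/cvgr0Pnorm_lt : lim; rewrite mulNr.
    by move=> /(_ _ e0).
  have small' : \forall n \near \oo, 0 < sigma ->
      Cc * n%:R `^ xi * tau n ^+ 2 + 2 * tau n ^+ 2 <= sigma ^+ 2 / 4.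
    have [/small [N0 _ HN]|s0] := boolP (0 < sigma).
      by exists N0 => // n /HN.
    by apply: nearW.
  near=> n; split; [| | | |split].
  - by near: n; exact: nbhs_infty_gt.
  - by near: n; exact: nbhs_infty_ge.
  - by near: n; move/cvgryPge : b6y; apply.
  - by near: n; move/cvgryPgt : b4y; apply.
  - by near: n; move/cvgryPgt : r2y; apply.
  - by near: n.
(* [E n] is empty as long as [n] is too small for the asymptotic conditions *)
pose E n := [set t | ok n /\ G n t].
have core n t : ok n -> G n t -> [/\
    forall k, k \notin supp (beta n) -> n%:R `^ mu *
      `|tilted b (X n) (C1 * tau n) k (response (X n) (beta n) (eps n) t)|
       <= r1 n,
    forall j, j \in supp (beta n) -> r2 n <= n%:R `^ mu *
      `|tilted b (X n) (C1 * tau n) j (response (X n) (beta n) (eps n) t)| &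
    b = true -> forall j, n%:R `^ mu *
      `|tilted b (X n) (C1 * tau n) j (response (X n) (beta n) (eps n) t)
         - beta n j 0| <= r1 n].
  move=> [n0 nN1 b6n b4n [r2n Ntau]] Gt.
  have [_ _ /(_ n0 _ Gt)[Xe e_le Qy]] := HG n.
  have [B0 BU U0 BsU] := U_ge n.
  have nm0 : 0 <= n%:R `^ mu :> R by exact: powR_ge0.
  have t0 : 0 <= tau n by exact: powR_ge0.
  have p0 : 0 <= C1 * tau n by rewrite mulr_ge0// ltW.
  have p20 : 0 <= C2 * tau n by rewrite mulr_ge0// ltW.
  have bM j : j \in supp (beta n) -> `|beta n j 0| <= M.
    by move=> jS; apply/ltW/A4a.
  have lam k : `|tilted true (X n) (C1 * tau n) k
      (response (X n) (beta n) (eps n) t) - beta n k 0| <= U n.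
    apply: le_trans BU.
    exact: (tilted_lambda (X n) (beta n) (C1 * tau n) alpha (Hcol n n0) al0
      (HA5 n n0) (K%:R * n%:R `^ delta) M (tau n) (C2 * tau n) (A1 n nN1) bM
      (ltW M0) p0 p20 (Aextra n n0)).
  have up k : k \notin supp (beta n) -> `|tilted b (X n) (C1 * tau n) k
      (response (X n) (beta n) (eps n) t)| <= U n.
    move=> kS; case: (b).
      by have := lam k; rewrite (betaN0 _ _ kS) subr0.
    apply: le_trans BsU.
    apply: (tilted_Lambda_upper (X n) (beta n) (C1 * tau n) alpha (Hcol n n0) al0
      (HA5 n n0) (K%:R * n%:R `^ delta) M (tau n) (C2 * tau n) (A1 n nN1) bM
      (ltW M0) p0 p20 (Aextra n n0)) => //.
    - exact: sqr_ge0.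
    - exact: (Qy k _ (A3 n n0 k) Ntau).
    - by move=> /(A6 n n0 k); exact: le_trans.
  have lo j : j \in supp (beta n) -> alpha * `|beta n j 0| - U n <=
      `|tilted b (X n) (C1 * tau n) j (response (X n) (beta n) (eps n) t)|.
    move=> jS; case: (b).
      have := lam j; rewrite distrC => H.
      have := lerB_dist (beta n j 0) (tilted true (X n) (C1 * tau n) j
        (response (X n) (beta n) (eps n) t)).
      have : alpha * `|beta n j 0| <= `|beta n j 0|.
        (* The factor [alpha < 1] is given away so that both rescalings share one lower bound. *)
        by rewrite ler_piMl// ltW.
      lra.
    have := tilted_Lambda_lower (X n) (beta n) (C1 * tau n) alpha (Hcol n n0) al0
      (HA5 n n0) (K%:R * n%:R `^ delta) M (tau n) (C2 * tau n) (A1 n nN1) bM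
      (ltW M0) p0 p20 (Aextra n n0) _ Xe j.
    apply: le_trans; rewrite lerD2l lerN2; apply: le_trans BU.
    by rewrite ler_pdivlMr// ler_piMr// ltW.
  split.
  - move=> k kS; apply: le_trans (U_le n n0); rewrite ler_wpM2l//; exact: up.
  - move=> j jS; apply: (@le_trans _ _ (n%:R `^ mu * (alpha * `|beta n j 0| - U n))).
      rewrite mulrBr mulrCA; apply: lerB; last exact: U_le.
      by rewrite ler_pM2l//; exact: A4b.
    by rewrite ler_wpM2l//; exact: lo.
  - move=> -> j; apply: le_trans (U_le n n0).
    by rewrite ler_wpM2l//; exact: lam.
have r1_ge0 n : 0 <= r1 n \/ n = 0%N.
  have [->|n0] := posnP n; [by right|left].
  apply: le_trans (U_le n n0); rewrite mulr_ge0 ?powR_ge0//.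
  by have [] := U_ge n.
exists E; split; [|split; [|split; [|split; [|split]]]].
- move=> n; rewrite /E; have [okn|okn] := pselect (ok n).
    rewrite (_ : [set t | _] = G n); first by have [] := HG n.
    by apply/seteqP; split => t //= -[].
  rewrite (_ : [set t | _] = set0)//.
  by rewrite -subset0 => t [].
(* Eventually [E n = G n], whose probability lies between [1 - q n] and 1. *)
- apply: (@squeeze_cvge _ _ _ _ (fun n => (1 - q n)%:E) _ (cst 1%E)).
  + near=> n.
    have okn : ok n by near: n.
    have n0 : (0 < n)%N by case: okn.
    have -> : E n = G n by apply/seteqP; split => t //= -[].
    have [mG PG _] := HG n; have {}PG := PG n0.
    rewrite probability_le1// andbT.
    move: PG; rewrite probability_setC//.
    rewrite -[P (G n)]fineK ?fin_num_measure// -EFinB !lee_fin; lra.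
  + apply: cvg_EFin; first by near=> n.
    have : 1 - q n @[n --> \oo] --> (1 - 0 : R).
      by apply: cvgB => //; exact: cvg_cst.
    by rewrite subr0.
  + exact: cvg_cst.
(* After multiplication by [n^mu], numerators are at most [r1] and denominators at least [r2]. *)
- exists (fun n => r1 n * (r2 n)^-1); split.
    rewrite -(mul0r (0 : R)); apply: cvgM => //.
    apply/gtr0_cvgV0 => //.
    by near=> n; have [_ _ _ _ []] : ok n by near: n.
  move=> n n0 t [okn Gt] j k jS kS.
  have [/(_ k kS) up /(_ j jS) lo _] := core n t okn Gt.
  have r2n : 0 < r2 n by case: okn => _ _ _ _ [].
  have nm0 : 0 < n%:R `^ mu :> R by rewrite powR_gt0// ltr0n.
  have r1n : 0 <= r1 n by case: (r1_ge0 n) n0 => // ->.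
  rewrite -(ler_pM2l nm0); apply: (le_trans up).
  set x := `|_|.
  have -> : n%:R `^ mu * (r1 n * (r2 n)^-1 * x) = r1 n * (n%:R `^ mu * x / r2 n).
    by ring.
  by rewrite ler_peMr// ler_pdivlMr// mul1r.
- exists r1; split => // n n0 t [okn Gt] k kS.
  by have [up _ _] := core n t okn Gt; exact: up.
- exists r2; split => // n n0 t [okn Gt] j jS.
  by have [_ lo _] := core n t okn Gt; exact: lo.
(* The absolute error [r1 / n^mu] is compared with [|beta_j| >= b4 / n^mu]. *)
- move=> bE; exists (fun n => r1 n * (b4 n)^-1); split.
    rewrite -(mul0r (0 : R)); apply: cvgM => //.
    apply/gtr0_cvgV0 => //.
    by near=> n; have [_ _ _ ? _] : ok n by near: n.
  move=> n n0 t [okn Gt] j jS.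
  have [_ _ /(_ bE j) la] := core n t okn Gt.
  have b4n : 0 < b4 n by case: okn.
  have bj0 : beta n j 0 != 0 by move: jS; rewrite inE.
  have nm0 : 0 < n%:R `^ mu :> R by rewrite powR_gt0// ltr0n.
  have nb : b4 n <= n%:R `^ mu * `|beta n j 0| by exact: A4b.
  set c := tilted _ _ _ _ _ in la *.
  have -> : c / beta n j 0 - 1 = (c - beta n j 0) / beta n j 0 by field.
  rewrite normrM normfV ler_pdivrMr ?normr_gt0//.
  rewrite -(ler_pM2l nm0); apply: (le_trans la).
  have r1n : 0 <= r1 n by case: (r1_ge0 n) n0 => // ->.
  have -> : n%:R `^ mu * (r1 n * (b4 n)^-1 * `|beta n j 0|) =
    r1 n * (n%:R `^ mu * `|beta n j 0| / b4 n) by ring.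
  by rewrite ler_peMr// ler_pdivlMr// mul1r.
Unshelve. all: by end_near. Qed.
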